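(* The intrinsic sublaplacian $\Delta_{\textup{sub}}^{T}$ on the trivializable subriemannian manifold $\mathbb{S}^7_T$, acting on $C^\infty(\mathbb{S}^7)$, is given by $$\Delta_{\textup{sub}}^{T}=-\sum_{i=1}^{4}\left(X_i^2+X_i(h)X_i\right),$$ where $$h(z):=-\frac{3}{2}\log\left(1-2\|x\|^2\|y\|^2\right)\quad\text{for } z=(x,y)\in\mathbb{S}^7.$$
   Context: Let $\mathbb{S}^7\subset\mathbb{R}^4\times\mathbb{R}^4\cong\mathbb{H}^2$ be the unit sphere with points $z=(x,y)$ and the standard metric. $\mathbb{S}^7_T$ is $\mathbb{S}^7$ with the step two bracket generating distribution $\mathcal{H}_T=\mathrm{Span}\{X_1,\dots,X_4\}$, $X_l(z)=A_lz$, where $$A_1(x,y)=(y{\bf k},x{\bf k}),\quad A_2(x,y)=(y{\bf j},x{\bf j}),\quad A_3(x,y)=(-y{\bf i},-x{\bf i}),\quad A_4(x,y)=(y,-x),$$ and with fiber inner product $\langle\cdot,\cdot\rangle$ on $\mathcal{H}_T$ the restriction of the standard metric ($X_1,\dots,X_4$ is an orthonormal frame). Popp measure: for a step two regular subriemannian manifold of dimension $n$ and rank $m$, choose a local frame $X_1,\dots,X_n$ of $TM$ with $X_1,\dots,X_m$ an orthonormal frame of $\mathcal{H}$, with dual coframe $\eta_1,\dots,\eta_n$; put $b_{ij}^k=\eta_k([X_i,X_j])$ for $1\le i,j\le m<k\le n$, $B^{kl}=\sum_{i,j=1}^mb_{ij}^kb_{ij}^l$, $B=(B^{kl})_{k,l=m+1}^n$.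 The Popp measure is $\mathcal{P}=\frac{1}{\sqrt{\det B}}\,\eta_1\wedge\cdots\wedge\eta_n$ (independent of the frame up to orientation). Intrinsic sublaplacian: $\Delta_{\textup{sub}}f=-\mathrm{div}_{\mathcal{P}}(\nabla_{\mathcal{H}}f)$, where $\mathrm{div}_{\mathcal{P}}$ is defined by $\mathcal{L}_X\mathcal{P}=\mathrm{div}_{\mathcal{P}}(X)\mathcal{P}$ and the horizontal gradient $\nabla_{\mathcal{H}}f\in\mathcal{H}$ by $\langle\nabla_{\mathcal{H}}f,v\rangle=df(v)$ for $v\in\mathcal{H}$. $\Delta_{\textup{sub}}^T$ is the intrinsic sublaplacian of $\mathbb{S}^7_T$. *)

(* Defs.v *)
From HB Require Import structures.
From mathcomp Require Import all_boot all_order all_algebra.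
From mathcomp Require Import all_classical all_reals all_analysis.

Set Implicit Arguments.
Unset Strict Implicit.
Unset Printing Implicit Defensive.

Import Order.TTheory GRing.Theory Num.Theory.
Import numFieldNormedType.Exports.

Local Open Scope classical_set_scope.
Local Open Scope ring_scope.

Section SmoothFunctions.
Context {R : realType} {n : nat}.
Implicit Types (U S : set 'rV[R]_n.+1) (f : 'rV[R]_n.+1 -> R).

Fixpoint Ck (k : nat) U f : Prop :=
  if k is k'.+1 then
    (forall x, U x -> differentiable f x) /\
    (forall i : 'I_n.+1, Ck k' U (fun x => 'D_(delta_mx 0 i) f x))
  else forall x, U x -> {for x, continuous f}.

Definition smooth U f : Prop := forall k, Ck k U f.

(* Smoothness of f restricted to an arbitrary subset S of the ambient space:
   f extends locally to smooth functions on open sets.  Only the values of f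
   on S matter. *)
Definition smooth_on S f : Prop :=
  forall p, S p -> exists U F,
    [/\ open U, U p, smooth U F & forall z, U z -> S z -> F z = f z].

Definition smooth_field_on S (X : 'rV[R]_n.+1 -> 'rV[R]_n.+1) : Prop :=
  forall j, smooth_on S (fun z => X z 0 j).

End SmoothFunctions.

Section Sphere.
Context {R : realType}.

(* The norm `|z| of the library on row vectors is the sup norm, hence a
   separate Euclidean structure. *)
Definition dotp {n} (u v : 'rV[R]_n) : R := (u *m v^T) 0 0.
Definition enorm {n} (u : 'rV[R]_n) : R := Num.sqrt (dotp u u).

Context {n : nat}.
Notation E := 'rV[R]_n.+1.

Definition sphere : set E := [set z | enorm z = 1].

Definition tangent (z : E) : {vspace E} := lker (linfun (mulmxr z^T)).

Definition sphere_proj (z : E) : E := (enorm z)^-1 *: z.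

(* For z on the sphere, v tangent at z and f a function on the sphere, this is
   df_z(v): f \o sphere_proj is the extension of f which is constant along
   rays, so that only the values of f on the sphere are used.  A field with
   values in E is differentiated componentwise. *)
Definition sdiff {V : normedModType R} (f : E -> V) (z v : E) : V :=
  'D_v (f \o sphere_proj) z.

Definition fder (X : E -> E) (f : E -> R) : E -> R := fun z => sdiff f z (X z).

(* The bracket such that [X, Y] f = X (Y f) - Y (X f). *)
Definition bracket (X Y : E -> E) : E -> E :=
  fun z => sdiff Y z (X z) - sdiff X z (Y z).

End Sphere.
Arguments sphere R n : clear implicits.

Section SubRiemannian.
(* A distribution H of rank m on the unit sphere of dimension m + r, with the
   inner product induced by the Euclidean one. *)
Context {R : realType} {m r : nat}.
Notation n := (m + r)%N.
Notation E := 'rV[R]_n.+1.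
Notation SS := (sphere R n).

(* P z v is the value of an n-form at z on the n-tuple of tangent vectors v. *)
Definition form := E -> ('I_n -> E) -> R.

Definition adapted_frame (H : E -> {vspace E}) (U : set E)
    (X : 'I_n -> E -> E) : Prop :=
  (forall i, smooth_field_on (U `&` SS) (X i)) /\
  forall z, U z -> SS z ->
    [/\ basis_of (tangent z) [seq X i z | i : 'I_n],
        basis_of (H z) [seq X (lshift r i) z | i : 'I_m] &
        forall i j : 'I_m,
          dotp (X (lshift r i) z) (X (lshift r j) z) = (i == j)%:R].

Definition dual_coframe (U : set E) (X : 'I_n -> E -> E)
    (eta : 'I_n -> E -> {scalar E}) : Prop :=
  forall z, U z -> SS z -> forall k j, eta k z (X j z) = (k == j)%:R.

Definition structure_coef (X : 'I_n -> E -> E) (eta : 'I_n -> E -> {scalar E})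
    (z : E) (k : 'I_r) (i j : 'I_m) : R :=
  eta (rshift m k) z (bracket (X (lshift r i)) (X (lshift r j)) z).

Definition popp_mx (X : 'I_n -> E -> E) (eta : 'I_n -> E -> {scalar E})
    (z : E) : 'M[R]_r :=
  \matrix_(k, l) \sum_(i < m) \sum_(j < m)
    structure_coef X eta z k i j * structure_coef X eta z l i j.

(* The n-form P is, near each point, (det B)^(-1/2) eta_1 /\ ... /\ eta_n for
   some choice of local adapted frame.  The sign (orientation) is left free. *)
Definition is_popp (H : E -> {vspace E}) (P : form) : Prop :=
  forall p, SS p -> exists U X eta,
    [/\ open U, U p, adapted_frame H U X, dual_coframe U X eta &
        forall z, U z -> SS z -> forall v : 'I_n -> E,
          (forall j, v j \in tangent z) ->
          P z v = (Num.sqrt (\det (popp_mx X eta z)))^-1 *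
                  \det (\matrix_(k, j) eta k z (v j))].

(* (L_X P)(Y_1, ..., Y_n) = X (P (Y_1, ..., Y_n))
                            - \sum_i P (Y_1, ..., [X, Y_i], ..., Y_n). *)
Definition Lie_form (X : E -> E) (P : form) (Y : 'I_n -> E -> E) (z : E) : R :=
  fder X (fun w => P w (fun j => Y j w)) z
  - \sum_i P z (fun j => if j == i then bracket X (Y i) z else Y j z).

Definition is_div (P : form) (X : E -> E) (d : E -> R) : Prop :=
  forall Y : 'I_n -> E -> E,
    (forall i, smooth_field_on SS (Y i)) ->
    (forall i z, SS z -> Y i z \in tangent z) ->
    forall z, SS z -> Lie_form X P Y z = d z * P z (fun j => Y j z).

Definition is_hgrad (H : E -> {vspace E}) (f : E -> R) (G : E -> E) : Prop :=
  forall z, SS z ->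
    G z \in H z /\ forall v, v \in H z -> dotp (G z) v = sdiff f z v.

(* g is the image of f under the intrinsic sublaplacian. *)
Definition is_sublaplacian (H : E -> {vspace E}) (f g : E -> R) : Prop :=
  exists (P : form) (G : E -> E) (d : E -> R),
    [/\ is_popp H P, is_hgrad H f G, is_div P G d &
        forall z, SS z -> g z = - d z].

End SubRiemannian.

Section TrivializableS7.
Context {R : realType}.

(* Quaternions as row vectors of coordinates with respect to 1, i, j, k. *)
Definition qmul (a b : 'rV[R]_4) : 'rV[R]_4 :=
  let a_ (i : nat) := a 0 (inord i) in
  let b_ (i : nat) := b 0 (inord i) in
  \row_l [:: a_ 0 * b_ 0 - a_ 1 * b_ 1 - a_ 2 * b_ 2 - a_ 3 * b_ 3;
             a_ 0 * b_ 1 + a_ 1 * b_ 0 + a_ 2 * b_ 3 - a_ 3 * b_ 2;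
             a_ 0 * b_ 2 - a_ 1 * b_ 3 + a_ 2 * b_ 0 + a_ 3 * b_ 1;
             a_ 0 * b_ 3 + a_ 1 * b_ 2 - a_ 2 * b_ 1 + a_ 3 * b_ 0]`_l.

Definition qi : 'rV[R]_4 := delta_mx 0 (inord 1).
Definition qj : 'rV[R]_4 := delta_mx 0 (inord 2).
Definition qk : 'rV[R]_4 := delta_mx 0 (inord 3).

Notation E := 'rV[R]_(4 + 4).

(* z = (x, y) *)
Definition xpart (z : E) : 'rV[R]_4 := lsubmx z.
Definition ypart (z : E) : 'rV[R]_4 := rsubmx z.

(* XT l is X_(l+1). *)
Definition XT (l : 'I_4) (z : E) : E :=
  let x := xpart z in let y := ypart z in
  [:: row_mx (qmul y qk) (qmul x qk);
      row_mx (qmul y qj) (qmul x qj);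
      row_mx (- qmul y qi) (- qmul x qi);
      row_mx y (- x)]`_l.

Definition HT (z : E) : {vspace E} := <<[seq XT l z | l : 'I_4]>>%VS.

Definition hT (z : E) : R :=
  - (3 / 2) * ln (1 - 2 * enorm (xpart z) ^+ 2 * enorm (ypart z) ^+ 2).

End TrivializableS7.

(* Main.v *)
(* The right multiplications defining XT commute with left multiplication by
   quaternions, so the fields (q x, - q y), q = i, j, k, complete z and the
   XT l z to an orthonormal basis. In this frame the matrix of Popp's
   construction is 16 (|x|^4 + |y|^4) times the identity, because
   conjugation by a quaternion a is |a|^2 times a rotation. As
   |x|^4 + |y|^4 = 1 - 2 |x|^2 |y|^2 on the sphere, and as changing the adapted
   frame by an orthogonal horizontal rotation does not change the construction,
   every Popp form is locally a constant times e^h det(z, ...). The Lie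
   derivative of det(z, ...) along G is tr(dG) det(z, ...), and for
   G = sum_l XT_l(f) XT_l this trace is sum_l XT_l(XT_l f), the XT_l being
   given by skew matrices. The factor e^h contributes G(h). *)

Require Import Defs.
From HB Require Import structures.
From mathcomp Require Import all_boot all_order all_algebra.
From mathcomp Require Import all_classical all_reals all_analysis.
From mathcomp Require Import ring.
Import Order.TTheory GRing.Theory Num.Theory.
Import numFieldNormedType.Exports.
Local Open Scope ring_scope.

Set Implicit Arguments.
Unset Strict Implicit.
Unset Printing Implicit Defensive.

(** * Derivatives of finite sums, products, determinants and composites *)

Section Differentiability.
Context {R : realType} {V : normedModType R}.
Implicit Types (W : normedModType R) (x v : V).

(** Besides the horizontal rotation, an adapted frame is free in its vertical fields. If [e] is the
    matrix of the vertical covectors on the [VT k z], Popp's matrix becomes [16 (|x|^4 + |y|^4)]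
    times [e e^T], and [det e] cancels against the scale of the coframe. Since [e] has size three,
    the density is the power -3/2 of [|x|^4 + |y|^4], which is where the 3/2 in [hT] comes from. Two
    obstacles shape the proof. Fields and functions are known on the sphere only, so the calculus is
    carried out for their extensions constant along rays. And the covectors [eta k z] act on the
    whole ambient space with an uncontrolled value at the normal [z], so they are corrected before
    determinants are compared. A Popp form carries a sign; only its local constancy is used, and it
    drops out because the divergence identity is linear in the form. The equivalence needs a Popp
    form to exist, and test fields on which it does not vanish; the global frame provides both. *)

Lemma near_eq_differentiable W (f g : V -> W) x :
  {near x, f =1 g} -> differentiable f x -> differentiable g x.
Proof.
move=> fg /diff_locallyP [cdf fE].
have gE : g \o shift x = cst (g x) + 'd f x +o_ (0 : V) id.
  apply/eqaddoP => e e0; move/eqaddoP: fE => /(_ e e0) H.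
  have xg := nbhs_singleton fg.
  have fg0 : \forall y \near (0 : V), f (y + x) = g (y + x).
    by move: fg; rewrite (near_shift 0) /= subr0.
  near=> y; rewrite -[_ y]/(g (y + x) - (g x + 'd f x y)) -xg.
  have <- : f (y + x) = g (y + x) by near: y.
  by near: y; exact: H.
apply/diff_locallyP.
by rewrite (diff_unique cdf gE).
Unshelve. all: by end_near. Qed.

Lemma differentiable_row n (f : V -> 'rV[R]_n) x :
  (forall j, differentiable (fun y => f y 0 j) x) -> differentiable f x.
Proof.
move=> df; have -> : f = \sum_j (fun y => f y 0 j *: (delta_mx 0 j : 'rV[R]_n)).
  by apply/funext => y; rewrite fct_sumE -row_sum_delta.
by apply: differentiable_sum => j; exact: differentiableZl.
Qed.

Lemma differentiable_row_coord n (f : V -> 'rV[R]_n) x j :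
  differentiable f x -> differentiable (fun y => f y 0 j) x.
Proof.
move=> df.
exact: (@differentiable_comp _ _ _ _ f (fun M => M 0 j) x df
  (differentiable_coord _ _ _)).
Qed.

Lemma derive_row n (f : V -> 'rV[R]_n) x v j :
  differentiable f x -> ('D_v f x) 0 j = 'D_v (fun y => f y 0 j) x.
Proof. by move=> df; rewrite derive_mx ?mxE//; exact: diff_derivable. Qed.

Lemma differentiable_mul (f g : V -> R) x :
  differentiable f x -> differentiable g x ->
  differentiable (fun y => f y * g y) x.
Proof. exact: differentiableM. Qed.

Lemma derive_mul (f g : V -> R) x v :
  differentiable f x -> differentiable g x ->
  'D_v (fun y => f y * g y) x = 'D_v f x * g x + f x * 'D_v g x.
Proof.
move=> df dg; rewrite [LHS](@deriveM _ _ f g); try exact: diff_derivable.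
by rewrite addrC mulrC.
Qed.

Lemma differentiable_bigsum W (I : Type) (r : seq I) (f : I -> V -> W) x :
  (forall i, differentiable (f i) x) ->
  differentiable (fun y => \sum_(i <- r) f i y) x.
Proof.
move=> df; elim: r => [|i r IH].
  under eq_fun do rewrite big_nil; exact: differentiable_cst.
under eq_fun do rewrite big_cons; exact: differentiableD.
Qed.

Lemma derive_bigsum W (I : Type) (r : seq I) (f : I -> V -> W) x v :
  (forall i, differentiable (f i) x) ->
  'D_v (fun y => \sum_(i <- r) f i y) x = \sum_(i <- r) 'D_v (f i) x.
Proof.
move=> df; elim: r => [|i r IH].
  under eq_fun do rewrite big_nil; rewrite big_nil; exact: derive_cst.
under eq_fun do rewrite big_cons; rewrite big_cons -IH.
apply: deriveD; apply: diff_derivable => //; exact: differentiable_bigsum.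
Qed.

Lemma differentiable_bigprod (I : Type) (r : seq I) (f : I -> V -> R) x :
  (forall i, differentiable (f i) x) ->
  differentiable (fun y => \prod_(i <- r) f i y) x.
Proof.
move=> df; elim: r => [|i r IH].
  under eq_fun do rewrite big_nil; exact: differentiable_cst.
under eq_fun do rewrite big_cons; exact: differentiable_mul.
Qed.

Lemma derive_bigprod (I : finType) (f : I -> V -> R) x v :
  (forall i, differentiable (f i) x) ->
  'D_v (fun y => \prod_i f i y) x =
  \sum_i \prod_j (if j == i then 'D_v (f j) x else f j x).
Proof.
(* The induction keeps the list duplicate-free: a repeated index would make [j == i] select two
   factors at once. *)
move=> df; elim: (index_enum I) (index_enum_uniq I) => [|i r IH] /=.
  under eq_fun do rewrite big_nil; rewrite big_nil => _; exact: derive_cst.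
case/andP => ir ur; under eq_fun do rewrite big_cons.
rewrite derive_mul//; last exact: differentiable_bigprod.
rewrite big_cons big_cons eqxx IH//; congr (_ * _ + _).
  rewrite big_seq [RHS]big_seq; apply: eq_bigr => j jr.
  by case: eqP jr ir => // -> ->.
rewrite mulr_sumr big_seq [RHS]big_seq; apply: eq_bigr => j jr.
by rewrite big_cons; case: eqP jr ir => // -> ->.
Qed.

Lemma differentiable_det n (A : V -> 'M[R]_n) x :
  (forall i j, differentiable (fun y => A y i j) x) ->
  differentiable (fun y => \det (A y)) x.
Proof.
move=> dA; apply: differentiable_bigsum => s.
apply: differentiable_mul; first exact: differentiable_cst.
exact: differentiable_bigprod.
Qed.

(** Leibniz rule in the Leibniz expansion, regrouped by rows: one determinant per row, matching the
    slot-by-slot form of [Lie_form]. *)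
Lemma derive_det n (A : V -> 'M[R]_n) x v :
  (forall i j, differentiable (fun y => A y i j) x) ->
  'D_v (fun y => \det (A y)) x =
  \sum_k \det (\matrix_(i, j) if i == k then 'D_v (fun y => A y i j) x
                              else A x i j).
Proof.
move=> dA; rewrite derive_bigsum; last first.
  move=> s; apply: differentiable_mul; first exact: differentiable_cst.
  exact: differentiable_bigprod.
rewrite exchange_big /=; apply: eq_bigr => s _.
rewrite derive_mul; last exact: differentiable_bigprod.
  rewrite [X in X * _]derive_cst mul0r add0r derive_bigprod// -mulr_sumr.
  congr (_ * _); apply: eq_bigr => k _; apply: eq_bigr => i _.
  by rewrite !mxE.
exact: differentiable_cst.
Qed.

Lemma differentiable_comp1 (f : R -> R) (g : V -> R) x :
  derivable f (g x) 1 -> differentiable g x -> differentiable (f \o g) x.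
Proof. by move=> /derivable1_diffP df dg; exact: differentiable_comp. Qed.

Lemma derive_comp1 (f : R -> R) (g : V -> R) x v :
  derivable f (g x) 1 -> differentiable g x ->
  'D_v (f \o g) x = 'D_v g x * 'D_1 f (g x).
Proof.
move=> df dg; rewrite deriveE; last exact: differentiable_comp1.
rewrite diff_comp//; last exact/derivable1_diffP.
by rewrite /= deriv1E// -derive1E deriveE.
Qed.

End Differentiability.

(** * The Euclidean inner product of row vectors *)

Section DotProduct.
Context {R : realType} {n : nat}.
Implicit Types u v w : 'rV[R]_n.

Lemma dotpE u v : dotp u v = \sum_j u 0 j * v 0 j.
Proof. by rewrite /dotp mxE; apply: eq_bigr => j _; rewrite mxE. Qed.

Lemma dotpC u v : dotp u v = dotp v u.
Proof. by rewrite !dotpE; apply: eq_bigr => j _; rewrite mulrC. Qed.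

Fact dotp_is_linear v : linear_for *%R (fun u => dotp u v).
Proof. by move=> a u w; rewrite /dotp mulmxDl -scalemxAl !mxE. Qed.

(** Packaged as a linear form, so that [dotp] inherits the lemmas on linear maps and can serve as
    the dual coframe of an orthonormal frame. *)
Definition dotp_scalar v : {scalar 'rV[R]_n} :=
  let f := fun u => dotp u v in
  HB.pack f (GRing.isLinear.Build R 'rV[R]_n R *%R f (dotp_is_linear v)).

Lemma dotpDl u v w : dotp (u + v) w = dotp u w + dotp v w.
Proof. exact: (linearD (dotp_scalar w)). Qed.

Lemma dotpBl u v w : dotp (u - v) w = dotp u w - dotp v w.
Proof. exact: (linearB (dotp_scalar w)). Qed.

Lemma dotpZl a u w : dotp (a *: u) w = a * dotp u w.
Proof. exact: (linearZ_LR (dotp_scalar w)). Qed.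

Lemma dotp_suml (I : Type) (r : seq I) (F : I -> 'rV[R]_n) w :
  dotp (\sum_(i <- r) F i) w = \sum_(i <- r) dotp (F i) w.
Proof. exact: (linear_sum (dotp_scalar w)). Qed.

Lemma dotpDr u v w : dotp w (u + v) = dotp w u + dotp w v.
Proof. by rewrite !(dotpC w) dotpDl. Qed.

Lemma dotpZr a u w : dotp w (a *: u) = a * dotp w u.
Proof. by rewrite !(dotpC w) dotpZl. Qed.

Lemma dotp_sumr (I : Type) (r : seq I) (F : I -> 'rV[R]_n) w :
  dotp w (\sum_(i <- r) F i) = \sum_(i <- r) dotp w (F i).
Proof. by rewrite dotpC dotp_suml; apply: eq_bigr => i _; rewrite dotpC. Qed.

Lemma dotp0r u : dotp u 0 = 0.
Proof. by rewrite dotpC; exact: (linear0 (dotp_scalar u)). Qed.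

Lemma dotpNr u v : dotp u (- v) = - dotp u v.
Proof. by rewrite !(dotpC u); exact: (linearN (dotp_scalar u)). Qed.

Lemma dotpNl u v : dotp (- u) v = - dotp u v.
Proof. by rewrite dotpC dotpNr dotpC. Qed.

Lemma dotp_ge0 u : 0 <= dotp u u.
Proof. by rewrite dotpE sumr_ge0// => j _; exact: sqr_ge0. Qed.

Lemma dotp_eq0 u : (dotp u u == 0) = (u == 0).
Proof.
apply/eqP/eqP => [|->]; last by rewrite /dotp mul0mx mxE.
rewrite dotpE => /eqP; rewrite psumr_eq0; last by move=> j _; exact: sqr_ge0.
move=> /allP u0; apply/rowP => j; rewrite mxE.
by have := u0 j (mem_index_enum j); rewrite /= mulf_eq0 orbb => /eqP.
Qed.

Lemma enorm_sqr u : enorm u ^+ 2 = dotp u u.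
Proof. by rewrite /enorm sqr_sqrtr// dotp_ge0. Qed.

End DotProduct.

(** * Differential calculus for functions known on the sphere *)

Section SphereCalculus.
Context {R : realType} {n : nat}.
Notation E := 'rV[R]_n.+1.
Notation SS := (sphere R n).
Implicit Types (z w v : E) (W : normedModType R) (U : set E).

Lemma sphereP z : SS z <-> dotp z z = 1.
Proof.
rewrite /sphere /= -enorm_sqr; split=> [->|/eqP]; first by rewrite expr1n.
by rewrite sqrf_eq1 => /orP[/eqP//|/eqP h]; have := sqrtr_ge0 (dotp z z);
   rewrite -/(enorm z) h ler0N1.
Qed.

Lemma tangentE z v : (v \in tangent z) = (dotp v z == 0).
Proof.
rewrite memv_ker lfunE /= /dotp; apply/eqP/eqP => [->|h]; first by rewrite mxE.
by apply/rowP => j; rewrite ord1 h mxE.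
Qed.

Lemma differentiable_dotp W (f g : W -> E) (x : W) :
  differentiable f x -> differentiable g x ->
  differentiable (fun y => dotp (f y) (g y)) x.
Proof.
move=> df dg; under eq_fun do rewrite dotpE.
by apply: differentiable_bigsum => j; apply: differentiable_mul;
   exact: differentiable_row_coord.
Qed.

Lemma derive_dotp W (f g : W -> E) (x u : W) :
  differentiable f x -> differentiable g x ->
  'D_u (fun y => dotp (f y) (g y)) x
  = dotp ('D_u f x) (g x) + dotp (f x) ('D_u g x).
Proof.
move=> df dg; under eq_fun do rewrite dotpE.
rewrite derive_bigsum; last first.
  by move=> j; apply: differentiable_mul; exact: differentiable_row_coord.
rewrite !dotpE -big_split; apply: eq_bigr => j _.
by rewrite derive_mul ?derive_row//; exact: differentiable_row_coord.
Qed.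

Lemma differentiable_id z : differentiable (fun w : E => w) z.
Proof. by case: (is_diff_id z). Qed.

Lemma differentiable_enorm z : SS z -> differentiable (@enorm R n.+1) z.
Proof.
move=> /sphereP z1; apply: (@differentiable_comp1 _ _ Num.sqrt).
  by apply: ex_derive; apply: is_derive1_sqrt; rewrite z1.
by apply: differentiable_dotp; exact: differentiable_id.
Qed.

(** Differentiating [enorm w * enorm w = dotp w w] spares the derivative of the square root. *)
Lemma derive_enorm z v : SS z -> 'D_v (@enorm R n.+1) z = dotp v z.
Proof.
move=> zS; have dn := differentiable_enorm zS.
have : 'D_v (fun w : E => enorm w * enorm w) z = 'D_v (fun w : E => dotp w w) z.
  by congr ('D_v _ z); apply/funext => w; rewrite -expr2 enorm_sqr.
rewrite derive_mul// derive_dotp; try exact: differentiable_id.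
rewrite derive_id zS mulr1 mul1r (dotpC z) -!mulr2n => /eqP.
by rewrite eqrMn2r => /eqP.
Qed.

Lemma sphere_proj_id z : SS z -> sphere_proj z = z.
Proof. by move=> zS; rewrite /sphere_proj zS invr1 scale1r. Qed.

Lemma sphere_proj_sphere z : enorm z != 0 -> SS (sphere_proj z).
Proof.
move=> z0; apply/sphereP; rewrite /sphere_proj dotpZl dotpZr -enorm_sqr.
by rewrite expr2 mulrA mulrA -invfM mulrAC -mulrA mulVf// mulf_neq0.
Qed.

Lemma near_enorm_neq0 z : SS z -> \forall w \near z, enorm w != 0.
Proof.
move=> zS; have /differentiable_continuous c := differentiable_enorm zS.
have : \forall x \near enorm z, x != 0.
  by apply: open_nbhs_nbhs; split; [exact: open_neq|rewrite zS /= oner_neq0].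
exact: c.
Qed.

Lemma differentiable_proj z : SS z -> differentiable (@sphere_proj R n) z.
Proof.
move=> zS; apply: differentiable_row => j.
under eq_fun do rewrite mxE.
apply: differentiable_mul.
  by apply: differentiableV; [exact: differentiable_enorm|rewrite zS oner_neq0].
exact: differentiable_coord.
Qed.

(** Differentiating [enorm w *: sphere_proj w = w], valid near [z], yields the orthogonal projection
    onto the tangent space. *)
Lemma derive_proj z v :
  SS z -> 'D_v (@sphere_proj R n) z = v - dotp v z *: z.
Proof.
move=> zS; apply/rowP => j.
have dp := differentiable_proj zS; have dn := differentiable_enorm zS.
rewrite derive_row//.
have : 'D_v (fun w : E => enorm w * sphere_proj w 0 j) z =
       'D_v (fun w : E => w 0 j) z.
  apply: near_eq_derive; near=> w; rewrite mxE mulrA mulfV ?mul1r//.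
  by near: w; exact: near_enorm_neq0.
rewrite derive_mul//; last exact: differentiable_row_coord.
rewrite -(derive_row v j (differentiable_id z)).
rewrite derive_id derive_enorm// zS mul1r sphere_proj_id// !mxE => <-.
by rewrite addrC addKr.
Unshelve. all: by end_near. Qed.

Lemma sphere_proj_near U z : open U -> U z -> SS z ->
  \forall w \near z, U (sphere_proj w) /\ SS (sphere_proj w).
Proof.
move=> oU Uz zS; have /differentiable_continuous c := differentiable_proj zS.
near=> w; split.
  near: w; apply: c; rewrite sphere_proj_id//; exact: open_nbhs_nbhs.
by apply: sphere_proj_sphere; near: w; exact: near_enorm_neq0.
Unshelve. all: by end_near. Qed.

(** Differentiability of the extension constant along rays, the function that [sdiff]
    differentiates. *)
Definition sdifferentiable W (f : E -> W) z := differentiable (f \o sphere_proj) z.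

Section Locality.
Variables (W : normedModType R) (U : set E) (f g : E -> W) (z : E).
Hypotheses (oU : open U) (Uz : U z) (zS : SS z).
Hypothesis fg : forall w, U w -> SS w -> f w = g w.

(** Rays close to [z] meet the sphere inside [U], so the two radial extensions agree on an ambient
    neighbourhood. *)
Let near_fg : {near z, f \o sphere_proj =1 g \o sphere_proj}.
Proof.
near=> w; have [] : U (sphere_proj w) /\ SS (sphere_proj w); last exact: fg.
by near: w; exact: sphere_proj_near.
Unshelve. all: by end_near. Qed.

Lemma eq_sdifferentiable : sdifferentiable f z -> sdifferentiable g z.
Proof. exact: near_eq_differentiable. Qed.

Lemma eq_sdiff v : sdiff f z v = sdiff g z v.
Proof. exact: near_eq_derive. Qed.

End Locality.

Lemma differentiable_sdifferentiable W (f : E -> W) z :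
  SS z -> differentiable f z -> sdifferentiable f z.
Proof.
move=> zS df; apply: differentiable_comp; first exact: differentiable_proj.
by rewrite sphere_proj_id.
Qed.

Lemma sdiffE W (f : E -> W) z v : SS z -> differentiable f z ->
  sdiff f z v = 'D_(v - dotp v z *: z) f z.
Proof.
move=> zS df; have dp := differentiable_proj zS.
rewrite /sdiff deriveE; last exact: differentiable_sdifferentiable.
rewrite diff_comp//; last by rewrite sphere_proj_id.
by rewrite /= sphere_proj_id// -(deriveE v dp) derive_proj// deriveE.
Qed.

Lemma sdiff_tangent W (f : E -> W) z v : SS z -> v \in tangent z ->
  differentiable f z -> sdiff f z v = 'D_v f z.
Proof.
by move=> zS; rewrite tangentE => /eqP v0 df; rewrite sdiffE// v0 scale0r subr0.
Qed.

Lemma sdiff_sum W (f : E -> W) z (I : Type) (r : seq I) (a : I -> R)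
    (u : I -> E) : sdifferentiable f z ->
  sdiff f z (\sum_(i <- r) a i *: u i) = \sum_(i <- r) a i *: sdiff f z (u i).
Proof.
move=> df; rewrite /sdiff deriveE// linear_sum.
by apply: eq_bigr => i _; rewrite linearZ deriveE.
Qed.

Lemma sdiff_normal W (f : E -> W) z : SS z -> sdifferentiable f z ->
  sdiff f z z = 0.
Proof.
move=> zS df; have /sphereP z1 := zS.
rewrite (@eq_sdiff _ setT f (f \o sphere_proj))//.
- by rewrite sdiffE// z1 scale1r subrr derive0.
- exact: openT.
- by move=> w _ wS; rewrite /= sphere_proj_id.
Qed.

Lemma sdifferentiable_cst W (a : W) z : sdifferentiable (fun=> a) z.
Proof. exact: differentiable_cst. Qed.

Lemma sdifferentiable_coord (f : E -> E) z j :
  sdifferentiable f z -> sdifferentiable (fun w => f w 0 j) z.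
Proof. exact: differentiable_row_coord. Qed.

Lemma sdifferentiable_row (f : E -> E) z :
  (forall j, sdifferentiable (fun w => f w 0 j) z) -> sdifferentiable f z.
Proof. by move=> df; exact: differentiable_row. Qed.

Lemma sdiff_coord (f : E -> E) z v j :
  sdifferentiable f z -> (sdiff f z v) 0 j = sdiff (fun w => f w 0 j) z v.
Proof. by move=> df; rewrite /sdiff derive_row. Qed.

Lemma sdifferentiable_mul (f g : E -> R) z :
  sdifferentiable f z -> sdifferentiable g z ->
  sdifferentiable (fun w => f w * g w) z.
Proof. exact: differentiable_mul. Qed.

Lemma sdiff_mul (f g : E -> R) z v : SS z ->
  sdifferentiable f z -> sdifferentiable g z ->
  sdiff (fun w => f w * g w) z v = sdiff f z v * g z + f z * sdiff g z v.
Proof.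
move=> zS df dg; rewrite /sdiff [LHS](derive_mul v df dg).
by rewrite /= sphere_proj_id.
Qed.

Lemma sdifferentiable_sum W (I : Type) (r : seq I) (f : I -> E -> W) z :
  (forall i, sdifferentiable (f i) z) ->
  sdifferentiable (fun w => \sum_(i <- r) f i w) z.
Proof. by move=> df; exact: differentiable_bigsum. Qed.

Lemma sdiff_bigsum W (I : Type) (r : seq I) (f : I -> E -> W) z v :
  (forall i, sdifferentiable (f i) z) ->
  sdiff (fun w => \sum_(i <- r) f i w) z v = \sum_(i <- r) sdiff (f i) z v.
Proof. by move=> df; exact: derive_bigsum. Qed.

Lemma sdifferentiable_dotp (f g : E -> E) z :
  sdifferentiable f z -> sdifferentiable g z ->
  sdifferentiable (fun w => dotp (f w) (g w)) z.
Proof. exact: differentiable_dotp. Qed.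

Lemma sdiff_dotp (f g : E -> E) z v : SS z ->
  sdifferentiable f z -> sdifferentiable g z ->
  sdiff (fun w => dotp (f w) (g w)) z v
  = dotp (sdiff f z v) (g z) + dotp (f z) (sdiff g z v).
Proof.
move=> zS df dg; rewrite /sdiff [LHS](derive_dotp v df dg).
by rewrite /= sphere_proj_id.
Qed.

Lemma sdifferentiable_scale (a : E -> R) (f : E -> E) z :
  sdifferentiable a z -> sdifferentiable f z ->
  sdifferentiable (fun w => a w *: f w) z.
Proof.
move=> da df; apply: sdifferentiable_row => j; under eq_fun do rewrite mxE.
by apply: sdifferentiable_mul => //; exact: sdifferentiable_coord.
Qed.

Lemma sdiff_scale (a : E -> R) (f : E -> E) z v : SS z ->
  sdifferentiable a z -> sdifferentiable f z ->
  sdiff (fun w => a w *: f w) z v = sdiff a z v *: f z + a z *: sdiff f z v.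
Proof.
move=> zS da df; apply/rowP => j.
rewrite sdiff_coord; last exact: sdifferentiable_scale.
under eq_fun do rewrite mxE.
rewrite sdiff_mul//; last exact: sdifferentiable_coord.
by rewrite !mxE sdiff_coord.
Qed.

Lemma sdifferentiable_det k (A : E -> 'M[R]_k) z :
  (forall i j, sdifferentiable (fun w => A w i j) z) ->
  sdifferentiable (fun w => \det (A w)) z.
Proof. by move=> dA; exact: differentiable_det. Qed.

Lemma sdiff_det k (A : E -> 'M[R]_k) z v : SS z ->
  (forall i j, sdifferentiable (fun w => A w i j) z) ->
  sdiff (fun w => \det (A w)) z v =
  \sum_l \det (\matrix_(i, j) if i == l then sdiff (fun w => A w i j) z v
                              else A z i j).
Proof.
move=> zS dA; rewrite /sdiff [LHS](derive_det v dA).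
apply: eq_bigr => l _; congr (\det _).
by apply/matrixP => i j; rewrite !mxE /= sphere_proj_id.
Qed.

Lemma sdifferentiable_comp1 (f : R -> R) (g : E -> R) z : SS z ->
  derivable f (g z) 1 -> sdifferentiable g z -> sdifferentiable (f \o g) z.
Proof.
by move=> zS df dg; apply: (@differentiable_comp1 _ _ f (g \o sphere_proj)) => //=;
   rewrite sphere_proj_id.
Qed.

Lemma sdiff_comp1 (f : R -> R) (g : E -> R) z v : SS z ->
  derivable f (g z) 1 -> sdifferentiable g z ->
  sdiff (f \o g) z v = sdiff g z v * 'D_1 f (g z).
Proof.
move=> zS df dg; rewrite /sdiff.
by rewrite [LHS](@derive_comp1 _ _ f (g \o sphere_proj)) /= ?sphere_proj_id.
Qed.

(** Serves to keep the orientation of a frame constant near a point. *)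
Lemma sdifferentiable_gt0 (f : E -> R) z : SS z -> sdifferentiable f z ->
  0 < f z -> exists U, [/\ open U, U z & forall w, U w -> SS w -> 0 < f w].
Proof.
move=> zS /differentiable_continuous c fz.
have : \forall x \near (f \o sphere_proj) z, 0 < x.
  by apply: open_nbhs_nbhs; split; [exact: open_gt|rewrite /= sphere_proj_id].
move=> /c; rewrite -/(nbhs z [set w | 0 < (f \o sphere_proj) w]%classic) nbhsE.
case=> U [oU Uz] UP; exists U; split => // w Uw wS.
by have := UP _ Uw; rewrite /= sphere_proj_id.
Qed.

End SphereCalculus.

(** * Determinants with one row replaced *)

Section RowReplacement.
Context {R : comNzRingType} {k : nat}.
Implicit Types (A L : 'M[R]_k) (u v : 'rV[R]_k) (i : 'I_k).

Definition set_row A i u : 'M[R]_k :=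
  \matrix_(a, b) if a == i then u 0 b else A a b.

Lemma det_set_row A i u : \det (set_row A i u) = (u *m \adj A) 0 i.
Proof.
rewrite (expand_det_row _ i) mxE; apply: eq_bigr => j _.
rewrite !mxE eqxx; congr (_ * _); rewrite /cofactor; congr (_ * \det _).
by apply/matrixP => a b; rewrite !mxE eq_sym (negPf (neq_lift _ _)).
Qed.

(** Jacobi's formula for the derivative of [\det] at [A] along [A *m L]; the adjugate makes it hold
    for singular [A] as well. *)
Lemma sum_det_set_row A L :
  \sum_i \det (set_row A i (row i A *m L)) = \tr L * \det A.
Proof.
transitivity (\tr (A *m L *m \adj A)).
  apply: eq_bigr => i _; rewrite det_set_row -row_mul !mxE.
  by apply: eq_bigr => j _; rewrite !mxE.
by rewrite mxtrace_mulC mulmxA mul_adj_mx mul_scalar_mx mxtraceZ mulrC.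
Qed.

End RowReplacement.

(** * The Lie derivative of the Euclidean volume form of the sphere *)

Section LieVolume.
Context {R : realType} {n : nat}.
Notation E := 'rV[R]_n.+1.
Notation SS := (sphere R n).
Implicit Types (z : E) (X G : E -> E) (Y : 'I_n -> E -> E).

(** Row zero is the unit normal, so on tangent vectors [\det (volmx z v)] is the Riemannian volume
    form of the sphere, up to orientation. *)
Definition volmx z (v : 'I_n -> E) : 'M[R]_n.+1 :=
  \matrix_(i, j) (oapp v z (unlift ord0 i)) 0 j.

Lemma volmx0 z v j : volmx z v ord0 j = z 0 j.
Proof. by rewrite mxE unlift_none. Qed.

Lemma volmxS z v i j : volmx z v (lift ord0 i) j = v i 0 j.
Proof. by rewrite mxE liftK. Qed.

Lemma volmx_set z v i u :
  volmx z (fun j => if j == i then u else v j)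
  = set_row (volmx z v) (lift ord0 i) u.
Proof.
apply/matrixP => a b; rewrite [RHS]mxE.
case: (unliftP ord0 a) => [a' ->|->].
  rewrite !volmxS (inj_eq lift_inj); by case: eqP.
by rewrite !volmx0.
Qed.

(** The column [z^T] is a nonzero kernel vector of [A]. *)
Lemma det_orthogonal (A : 'M[R]_n.+1) z : SS z ->
  (forall i, dotp (row i A) z = 0) -> \det A = 0.
Proof.
move=> zS Az; apply/eqP; rewrite -det_tr; apply/det0P; exists z.
  by rewrite -dotp_eq0; move/sphereP: zS => ->; exact: oner_neq0.
apply/rowP => i; rewrite [RHS]mxE -(Az i) dotpC dotpE mxE.
by apply: eq_bigr => j _; rewrite !mxE.
Qed.

Lemma sdiff_id z v : SS z -> v \in tangent z -> sdiff (fun w : E => w) z v = v.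
Proof. by move=> zS vt; rewrite sdiff_tangent// derive_id. Qed.

(** Differentiating [dotp (Z w) w = 0] along [v] gives the normal part of [sdiff Z z v] as
    [- dotp (Z z) v]; this is symmetric, so the two normal parts in the bracket cancel. *)
Lemma bracket_tangent X G z : SS z ->
  (forall w, SS w -> X w \in tangent w) -> (forall w, SS w -> G w \in tangent w) ->
  sdifferentiable X z -> sdifferentiable G z -> bracket X G z \in tangent z.
Proof.
move=> zS Xt Gt dX dG.
have idd := differentiable_sdifferentiable zS (differentiable_id z).
have D Z v : (forall w, SS w -> Z w \in tangent w) -> sdifferentiable Z z ->
    v \in tangent z -> dotp (sdiff Z z v) z = - dotp (Z z) v.
  move=> Zt dZ vt; have := sdiff_dotp v zS dZ idd.
  rewrite sdiff_id//.
  rewrite -(@eq_sdiff _ _ _ setT (fun=> 0))//.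
  - by rewrite [LHS]derive_cst => /esym/eqP; rewrite addr_eq0 => /eqP.
  - exact: openT.
  - by move=> w _ wS; apply/esym/eqP; rewrite -tangentE Zt.
rewrite tangentE /bracket dotpBl D//; last exact: Xt.
by rewrite D//; [rewrite dotpC subrr|exact: Gt].
Qed.

Definition sdiff_mx G z : 'M[R]_n.+1 :=
  \matrix_(i, j) (sdiff G z (delta_mx 0 i)) 0 j.

Lemma sdiff_mxE G z v : sdifferentiable G z -> v *m sdiff_mx G z = sdiff G z v.
Proof.
move=> dG; rewrite [in RHS](row_sum_delta v) sdiff_sum//.
apply/rowP => j; rewrite mxE summxE.
by apply: eq_bigr => i _; rewrite !mxE.
Qed.

(* The divergence of G with respect to the volume form det(z, ...) is the trace
   of dG, where dG kills z. *)
Lemma Lie_vol G Y z : SS z -> sdifferentiable G z -> G z \in tangent z ->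
  (forall i, sdifferentiable (Y i) z) -> (forall i, Y i z \in tangent z) ->
  fder G (fun w => \det (volmx w (fun i => Y i w))) z
  - \sum_i \det (volmx z (fun j => if j == i then bracket G (Y i) z else Y j z))
  = \tr (sdiff_mx G z) * \det (volmx z (fun i => Y i z)).
Proof.
move=> zS dG Gt dY Yt.
have idd := differentiable_sdifferentiable zS (differentiable_id z).
have dA i j : sdifferentiable (fun w => volmx w (fun i => Y i w) i j) z.
  case: (unliftP ord0 i) => [i' ->|->].
    by under eq_fun do rewrite volmxS; exact: sdifferentiable_coord.
  by under eq_fun do rewrite volmx0; exact: sdifferentiable_coord idd.
set A := volmx z _.
have repl l (u : E) :
  (forall j, u 0 j = sdiff (fun w => volmx w (Y^~ w) l j) z (G z)) ->
  \det (\matrix_(i, j) (if i == l then sdiff (fun w => volmx w (Y^~ w) i j) z (G z)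
                                  else volmx z (Y^~ z) i j))
  = (u *m \adj A) 0 l.
  move=> uE; rewrite -det_set_row; congr (\det _); apply/matrixP => a b.
  by rewrite !mxE; case: eqP => // ->; rewrite uE.
rewrite /fder sdiff_det// big_ord_recl -addrA.
(* Differentiating row zero turns the normal [z] into the tangent vector [G z], after which every
   row is orthogonal to [z]. *)
rewrite [X in X + _](_ : _ = 0) ?add0r; last first.
  apply: (det_orthogonal zS) => i.
  apply/eqP; rewrite -tangentE; case: (unliftP ord0 i) => [i' ->|->].
    rewrite [row _ _](_ : _ = Y i' z)//.
    by apply/rowP => j; rewrite mxE mxE /= volmxS.
  rewrite [row _ _](_ : _ = G z)//.
  apply/rowP => j; rewrite mxE mxE eqxx.
  under eq_fun do rewrite volmx0.
  by rewrite -sdiff_coord// sdiff_id.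
(* In the trace formula, row zero contributes the derivative of [G] along [z], which is zero for a
   radial extension. *)
rewrite -sum_det_set_row big_ord_recl [X in _ = X + _](_ : _ = 0) ?add0r; last first.
  rewrite det_set_row sdiff_mxE// (_ : row _ _ = z) ?sdiff_normal// ?mul0mx ?mxE//.
  by apply/rowP => j; rewrite mxE volmx0.
rewrite -sumrB; apply: eq_bigr => i _.
rewrite (repl _ (sdiff (Y i) z (G z))); last first.
  by move=> j; rewrite sdiff_coord//; under [in RHS]eq_fun do rewrite volmxS.
rewrite volmx_set !det_set_row sdiff_mxE// (_ : row _ _ = Y i z); last first.
  by apply/rowP => j; rewrite mxE volmxS.
(* Subtracting the bracket from [sdiff (Y i) z (G z)] leaves [sdiff G z (Y i z)]. *)
rewrite -/A /bracket mulmxBl [in X in _ - X]mxE [in X in _ - (_ + X)]mxE opprB.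
by rewrite addrCA subrr addr0.
Qed.

End LieVolume.

(** * The quaternionic frame and its brackets *)

Section Frame.
Context {R : realType}.
Notation E := 'rV[R]_8.
Implicit Types (a b c d : 'rV[R]_4) (u v z : E).

(* Together with z and the XT l z these are orthonormal: left multiplications
   commute with the right multiplications defining XT. *)
Definition VT (k : 'I_3) (z : E) : E :=
  let x := xpart z in let y := ypart z in
  [:: row_mx (qmul qi x) (- qmul qi y);
      row_mx (qmul qj x) (- qmul qj y);
      row_mx (qmul qk x) (- qmul qk y)]`_k.

Definition FT (i : 'I_(4 + 3)) : E -> E :=
  match fintype.split i with inl l => XT l | inr k => VT k end.

Lemma FT_lshift l : FT (@lshift 4 3 l) = XT l.
Proof. by rewrite /FT -[lshift 3 l]/(unsplit (inl l)) unsplitK. Qed.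

Lemma FT_rshift k : FT (@rshift 4 3 k) = VT k.
Proof. by rewrite /FT -[rshift 4 k]/(unsplit (inr k)) unsplitK. Qed.

Lemma ord4_ind (P : 'I_4 -> Prop) :
  P (inord 0) -> P (inord 1) -> P (inord 2) -> P (inord 3) -> forall i, P i.
Proof.
move=> P0 P1 P2 P3 i; rewrite -(inord_val i).
by case: i => [[|[|[|[|]]]]] /=.
Qed.

Lemma dotp_row_mx a b c d :
  dotp (row_mx a b) (row_mx c d) = dotp a c + dotp b d.
Proof. by rewrite /dotp tr_row_mx mul_row_col mxE. Qed.

Lemma dotp4E a b :
  dotp a b = a 0 (inord 0) * b 0 (inord 0) + a 0 (inord 1) * b 0 (inord 1)
           + a 0 (inord 2) * b 0 (inord 2) + a 0 (inord 3) * b 0 (inord 3).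
Proof.
rewrite dotpE !big_ord_recl big_ord0 addr0 !addrA.
by do !congr (_ + _); congr (_ * _); congr (_ 0 _); apply/val_inj; rewrite /= inordK.
Qed.

Lemma dotp_parts u v :
  dotp u v = dotp (xpart u) (xpart v) + dotp (ypart u) (ypart v).
Proof.
rewrite -[u in LHS](@hsubmxK _ 1 4 4) -[v in LHS](@hsubmxK _ 1 4 4).
exact: dotp_row_mx.
Qed.

Lemma qmul0 a b : qmul a b 0 (inord 0) =
  a 0 (inord 0) * b 0 (inord 0) - a 0 (inord 1) * b 0 (inord 1)
  - a 0 (inord 2) * b 0 (inord 2) - a 0 (inord 3) * b 0 (inord 3).
Proof. by rewrite mxE inordK. Qed.

Lemma qmul1 a b : qmul a b 0 (inord 1) =
  a 0 (inord 0) * b 0 (inord 1) + a 0 (inord 1) * b 0 (inord 0)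
  + a 0 (inord 2) * b 0 (inord 3) - a 0 (inord 3) * b 0 (inord 2).
Proof. by rewrite mxE inordK. Qed.

Lemma qmul2 a b : qmul a b 0 (inord 2) =
  a 0 (inord 0) * b 0 (inord 2) - a 0 (inord 1) * b 0 (inord 3)
  + a 0 (inord 2) * b 0 (inord 0) + a 0 (inord 3) * b 0 (inord 1).
Proof. by rewrite mxE inordK. Qed.

Lemma qmul3 a b : qmul a b 0 (inord 3) =
  a 0 (inord 0) * b 0 (inord 3) + a 0 (inord 1) * b 0 (inord 2)
  - a 0 (inord 2) * b 0 (inord 1) + a 0 (inord 3) * b 0 (inord 0).
Proof. by rewrite mxE inordK. Qed.

Lemma qunit_coord (i j : nat) : (i < 4)%N -> (j < 4)%N ->
  (delta_mx 0 (inord i) : 'rV[R]_4) 0 (inord j) = (j == i)%:R.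
Proof. by move=> ilt jlt; rewrite mxE eqxx -val_eqE /= !inordK. Qed.

Let coordN a i : (- a) 0 i = - a 0 i. Proof. by rewrite mxE. Qed.

Let coordB a b i : (a - b) 0 i = a 0 i - b 0 i. Proof. by rewrite !mxE. Qed.

Lemma xpart_row_mx a b : xpart (row_mx a b : E) = a.
Proof. exact: row_mxKl. Qed.

Lemma ypart_row_mx a b : ypart (row_mx a b : E) = b.
Proof. exact: row_mxKr. Qed.

Lemma xpartB u v : xpart (u - v) = xpart u - xpart v.
Proof. by apply/rowP => i; rewrite !mxE. Qed.

Lemma ypartB u v : ypart (u - v) = ypart u - ypart v.
Proof. by apply/rowP => i; rewrite !mxE. Qed.

Let coordE := (dotp_parts, dotp4E, xpartB, ypartB, xpart_row_mx, ypart_row_mx,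
  coordN, coordB).

Ltac unit_coords :=
  rewrite ?(qmul0, qmul1, qmul2, qmul3) /qi /qj /qk ?qunit_coord// /=.

Let qmul_qi a :
  (qmul a qi 0 (inord 0) = - a 0 (inord 1)) *
  (qmul a qi 0 (inord 1) = a 0 (inord 0)) *
  (qmul a qi 0 (inord 2) = a 0 (inord 3)) *
  (qmul a qi 0 (inord 3) = - a 0 (inord 2)).
Proof. by do !split; unit_coords; ring. Qed.

Let qmul_qj a :
  (qmul a qj 0 (inord 0) = - a 0 (inord 2)) *
  (qmul a qj 0 (inord 1) = - a 0 (inord 3)) *
  (qmul a qj 0 (inord 2) = a 0 (inord 0)) *
  (qmul a qj 0 (inord 3) = a 0 (inord 1)).
Proof. by do !split; unit_coords; ring. Qed.

Let qmul_qk a :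
  (qmul a qk 0 (inord 0) = - a 0 (inord 3)) *
  (qmul a qk 0 (inord 1) = a 0 (inord 2)) *
  (qmul a qk 0 (inord 2) = - a 0 (inord 1)) *
  (qmul a qk 0 (inord 3) = a 0 (inord 0)).
Proof. by do !split; unit_coords; ring. Qed.

Let qi_qmul a :
  (qmul qi a 0 (inord 0) = - a 0 (inord 1)) *
  (qmul qi a 0 (inord 1) = a 0 (inord 0)) *
  (qmul qi a 0 (inord 2) = - a 0 (inord 3)) *
  (qmul qi a 0 (inord 3) = a 0 (inord 2)).
Proof. by do !split; unit_coords; ring. Qed.

Let qj_qmul a :
  (qmul qj a 0 (inord 0) = - a 0 (inord 2)) *
  (qmul qj a 0 (inord 1) = a 0 (inord 3)) *
  (qmul qj a 0 (inord 2) = a 0 (inord 0)) *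
  (qmul qj a 0 (inord 3) = - a 0 (inord 1)).
Proof. by do !split; unit_coords; ring. Qed.

Let qk_qmul a :
  (qmul qk a 0 (inord 0) = - a 0 (inord 3)) *
  (qmul qk a 0 (inord 1) = - a 0 (inord 2)) *
  (qmul qk a 0 (inord 2) = a 0 (inord 1)) *
  (qmul qk a 0 (inord 3) = a 0 (inord 0)).
Proof. by do !split; unit_coords; ring. Qed.

Let unitE := (qmul_qi, qmul_qj, qmul_qk, qi_qmul, qj_qmul, qk_qmul).

(** This and the next frame relations are polynomial identities on the whole ambient space;
    expansion into the eight coordinates leaves them to [ring]. *)
Lemma dotp_XT l m z : dotp (XT l z) (XT m z) = (l == m)%:R * dotp z z.
Proof.
case: l => [[|[|[|[|]]]] ?]//; case: m => [[|[|[|[|]]]] ?]//;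
rewrite /XT /= !(coordE, unitE); ring.
Qed.

Lemma dotp_VT k l z : dotp (VT k z) (VT l z) = (k == l)%:R * dotp z z.
Proof.
case: k => [[|[|[|]]] ?]//; case: l => [[|[|[|]]] ?]//;
rewrite /VT /= !(coordE, unitE); ring.
Qed.

Lemma dotp_VT_XT k l z : dotp (VT k z) (XT l z) = 0.
Proof.
case: k => [[|[|[|]]] ?]//; case: l => [[|[|[|[|]]]] ?]//;
rewrite /VT /XT /= !(coordE, unitE); ring.
Qed.

Lemma dotp_XT_id l z : dotp (XT l z) z = 0.
Proof.
case: l => [[|[|[|[|]]]] ?]//; rewrite /XT /= !(coordE, unitE); ring.
Qed.

Lemma dotp_VT_id k z : dotp (VT k z) z = 0.
Proof. case: k => [[|[|[|]]] ?]//; rewrite /VT /= !(coordE, unitE); ring. Qed.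

(* The value at z of the bracket of XT k and XT l. *)
Definition TT (k l : 'I_4) (z : E) : E := XT l (XT k z) - XT k (XT l z).

Lemma qmulPl t a b c : qmul (t *: a + b) c = t *: qmul a c + qmul b c.
Proof. by apply/rowP; elim/ord4_ind; rewrite !(mxE, inordK)//=; ring. Qed.

Lemma qmulPr t a b c : qmul c (t *: a + b) = t *: qmul c a + qmul c b.
Proof. by apply/rowP; elim/ord4_ind; rewrite !(mxE, inordK)//=; ring. Qed.

Lemma xpartP t u v : xpart (t *: u + v) = t *: xpart u + xpart v.
Proof. by apply/rowP => i; rewrite !mxE. Qed.

Lemma ypartP t u v : ypart (t *: u + v) = t *: ypart u + ypart v.
Proof. by apply/rowP => i; rewrite !mxE. Qed.

Let row_mxP t a b c d :
  row_mx (t *: a + b) (t *: c + d) = t *: row_mx a c + row_mx b d.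
Proof. by rewrite scale_row_mx add_row_mx. Qed.

Fact XT_is_linear l : linear (XT l : 'rV[R]_(4 + 4) -> 'rV[R]_(4 + 4)).
Proof.
move=> t u v; rewrite /XT xpartP ypartP.
case: l => [[|[|[|[|]]]] ?]//=; rewrite ?qmulPl -row_mxP;
  by rewrite ?scalerN -?opprD.
Qed.

Fact VT_is_linear k : linear (VT k : 'rV[R]_(4 + 4) -> 'rV[R]_(4 + 4)).
Proof.
move=> t u v; rewrite /VT xpartP ypartP.
case: k => [[|[|[|]]] ?]//=; by rewrite !qmulPr -row_mxP scalerN -opprD.
Qed.

(** Reduces sixteen terms to six pairs; the indices are spelled as [big_ord_recl] produces them. *)
Lemma sum_sym4 (F : 'I_4 -> 'I_4 -> R) :
  (forall k, F k k = 0) -> (forall k l, F k l = F l k) ->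
  let o1 : 'I_4 := lift ord0 (ord0 : 'I_3) in
  let o2 : 'I_4 := lift ord0 (lift ord0 (ord0 : 'I_2) : 'I_3) in
  let o3 : 'I_4 := lift ord0 (lift ord0 (lift ord0 (ord0 : 'I_1) : 'I_2) : 'I_3) in
  \sum_k \sum_l F k l =
  2 * (F ord0 o1 + F ord0 o2 + F ord0 o3 + F o1 o2 + F o1 o3 + F o2 o3).
Proof.
move=> F0 Fs o1 o2 o3; rewrite !big_ord_recl !big_ord0 !F0.
rewrite -/o1 -/o2 -/o3 !(Fs _ ord0) (Fs o2 o1) (Fs o3 o1) (Fs o3 o2).
ring.
Qed.

Definition qimag (m : 'I_3) : 'rV[R]_4 := [:: qi; qj; qk]`_m.

(* Conjugation by a is |a|^2 times a rotation of the imaginary quaternions. *)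
Lemma sum_dotp_conj p q a :
  \sum_(m < 3) dotp (qmul (qimag p) a) (qmul a (qimag m))
               * dotp (qmul (qimag q) a) (qmul a (qimag m))
  = dotp a a ^+ 2 * (p == q)%:R.
Proof.
rewrite !big_ord_recl !big_ord0.
case: p => [[|[|[|]]] ?]//; case: q => [[|[|[|]]] ?]//;
rewrite /qimag /= !(coordE, unitE); ring.
Qed.

(** Each imaginary unit belongs to two of the six brackets, once with the sum [d + e] and once with
    a difference of [d] and [e]. *)
Lemma dotp_TT a b z :
  let o1 : 'I_4 := lift ord0 (ord0 : 'I_3) in
  let o2 : 'I_4 := lift ord0 (lift ord0 (ord0 : 'I_2) : 'I_3) in
  let o3 : 'I_4 := lift ord0 (lift ord0 (lift ord0 (ord0 : 'I_1) : 'I_2) : 'I_3) in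
  let d c := dotp a (qmul (xpart z) c) in
  let e c := dotp b (qmul (ypart z) c) in
  let v : E := row_mx a b in
  (dotp v (TT ord0 o1 z) = - 2 * (d qi + e qi)) *
  (dotp v (TT ord0 o2 z) = - 2 * (d qj + e qj)) *
  (dotp v (TT ord0 o3 z) = 2 * (d qk - e qk)) *
  (dotp v (TT o1 o2 z) = 2 * (d qk + e qk)) *
  (dotp v (TT o1 o3 z) = 2 * (d qj - e qj)) *
  (dotp v (TT o2 o3 z) = - 2 * (d qi - e qi)).
Proof.
move=> o1 o2 o3 d e v; rewrite /v /d /e /TT /XT /=.
do !split; rewrite !(coordE, unitE); ring.
Qed.

(** For each unit, the mixed products of the [x] and [y] terms cancel between the sum and the
    difference. The 16 is 2 for the order of the indices, 4 for the product of two factors 2 in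
    [dotp_TT], and 2 for the terms doubled by this cancellation. *)
Lemma sum_dotp_VT_TT p q (z : E) :
  \sum_k \sum_l dotp (VT p z) (TT k l z) * dotp (VT q z) (TT k l z)
  = 16 * (dotp (xpart z) (xpart z) ^+ 2 + dotp (ypart z) (ypart z) ^+ 2)
    * (p == q)%:R.
Proof.
have VE m : VT m z = row_mx (qmul (qimag m) (xpart z)) (- qmul (qimag m) (ypart z)).
  by case: m => [[|[|[|]]] ?].
rewrite sum_sym4; first last.
- by move=> k l; rewrite /TT -opprB !dotpNr mulrNN.
- by move=> k; rewrite /TT subrr dotp0r mul0r.
rewrite -mulrA [in X in _ = _ * X]mulrDl -!sum_dotp_conj !big_ord_recl !big_ord0.
rewrite !VE !dotp_TT !dotpNl /qimag /=; ring.
Qed.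

End Frame.

(** * Linear fields and consequences of smoothness *)

Section SmoothFields.
Context {R : realType} {n : nat}.
Notation E := 'rV[R]_n.+1.
Notation SS := (sphere R n).
Implicit Types (z v a : E) (U S : set E) (f : E -> R).

Lemma Ck_cst k U (c : R) : Ck k U (fun=> c).
Proof.
elim: k c => [|k IH] c /=; first by move=> x _; exact: cst_continuous.
split=> [x _|i]; first exact: differentiable_cst.
have -> : (fun x : E => 'D_(delta_mx 0 i) (fun=> c) x) = (fun=> 0) :> (E -> R).
  by apply/funext => x; exact: derive_cst.
exact: IH.
Qed.

Lemma smooth_dotp U a : smooth U (fun z => dotp z a).
Proof.
have dd z : differentiable (fun w => dotp w a) z.
  by apply: differentiable_dotp; [exact: differentiable_id|exact: differentiable_cst].
case=> [|k] /=; first by move=> x _; exact: differentiable_continuous.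
split=> [x _|i]; first exact: dd.
have -> : (fun z : E => 'D_(delta_mx 0 i) (fun w : E => dotp w a) z)
          = (fun=> dotp (delta_mx 0 i) a).
  apply/funext => z; rewrite derive_dotp; last 2 first.
  - exact: differentiable_id.
  - exact: differentiable_cst.
  by rewrite derive_id derive_cst dotp0r addr0.
exact: Ck_cst.
Qed.

Lemma linear_coordE (f : {linear E -> E}) z j :
  f z 0 j = dotp z (\row_i f (delta_mx 0 i) 0 j).
Proof.
rewrite [in LHS](row_sum_delta z) linear_sum summxE dotpE.
by apply: eq_bigr => i _; rewrite linearZ !mxE.
Qed.

Lemma smooth_linear_field S (f : {linear E -> E}) : smooth_field_on S f.
Proof.
move=> j p Sp; exists setT, (fun z => f z 0 j); split => //; first exact: openT.
by under eq_fun do rewrite linear_coordE; exact: smooth_dotp.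
Qed.

Lemma differentiable_linear_field (f : {linear E -> E}) z : differentiable f z.
Proof.
apply: differentiable_row => j; under eq_fun do rewrite linear_coordE.
by apply: differentiable_dotp; [exact: differentiable_id|exact: differentiable_cst].
Qed.

Lemma derive_linear_field (f : {linear E -> E}) z v : 'D_v f z = f v.
Proof.
apply/rowP => j; rewrite derive_row; last exact: differentiable_linear_field.
under eq_fun do rewrite linear_coordE; rewrite derive_dotp; last 2 first.
- exact: differentiable_id.
- exact: differentiable_cst.
by rewrite derive_id derive_cst dotp0r addr0 -linear_coordE.
Qed.

Lemma sdifferentiable_linear (f : {linear E -> E}) z :
  SS z -> sdifferentiable f z.
Proof.
move=> zS; apply: differentiable_sdifferentiable => //.
exact: differentiable_linear_field.
Qed.

Lemma sdiff_linear (f : {linear E -> E}) z v :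
  SS z -> sdiff f z v = f (v - dotp v z *: z).
Proof.
move=> zS; rewrite sdiffE ?derive_linear_field//.
exact: differentiable_linear_field.
Qed.

Lemma smooth_on_sdifferentiable U f z : open U -> U z -> SS z ->
  smooth_on (U `&` SS) f -> sdifferentiable f z.
Proof.
move=> oU Uz zS /(_ z (conj Uz zS)) [V [F [oV Vz sF FE]]].
apply: (@eq_sdifferentiable _ _ _ (V `&` U)%classic F) => //.
- exact: openI.
- by move=> w [Vw Uw] wS; exact: FE.
apply: differentiable_sdifferentiable => //.
by have [dF _] := sF 1%N; exact: dF.
Qed.

Lemma smooth_field_sdifferentiable U (X : E -> E) z : open U -> U z -> SS z ->
  smooth_field_on (U `&` SS) X -> sdifferentiable X z.
Proof.
move=> oU Uz zS sX; apply: sdifferentiable_row => j.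
exact: smooth_on_sdifferentiable (sX j).
Qed.

Lemma smooth_field_sphere_sdifferentiable (X : E -> E) z : SS z ->
  smooth_field_on SS X -> sdifferentiable X z.
Proof.
move=> zS sX; apply: (@smooth_field_sdifferentiable setT) => //; first exact: openT.
by rewrite setTI.
Qed.

Lemma smooth_on_sphere_sdifferentiable f z : SS z ->
  smooth_on SS f -> sdifferentiable f z.
Proof.
move=> zS sf; apply: (@smooth_on_sdifferentiable setT) => //; first exact: openT.
by rewrite setTI.
Qed.

(** Near [z], with [F] a local smooth extension of [f], tangency of [X] writes [fder X f] through
    the partial derivatives of [F], which are again differentiable. *)
Lemma smooth_on_fder_sdifferentiable f (X : {linear E -> E}) z : SS z ->
  (forall w, SS w -> X w \in tangent w) ->
  smooth_on SS f -> sdifferentiable (fder X f) z.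
Proof.
move=> zS Xt /(_ z zS) [V [F [oV Vz sF FE]]].
have [dF _] := sF 1%N; have [_ dF2] := sF 2.
apply: (@eq_sdifferentiable _ _ _ V
  (fun w => \sum_j X w 0 j * 'D_(delta_mx 0 j) F w)) => //.
  move=> w Vw wS; rewrite /fder -(@eq_sdiff _ _ _ V F f)//.
  rewrite sdiff_tangent ?Xt//; last exact: dF.
  rewrite [in RHS](row_sum_delta (X w)) deriveE; last exact: dF.
  rewrite linear_sum; apply: eq_bigr => j _.
  by rewrite linearZ -deriveE//; exact: dF.
apply: sdifferentiable_sum => j; apply: sdifferentiable_mul.
  exact/sdifferentiable_coord/sdifferentiable_linear.
apply: differentiable_sdifferentiable => //.
by have [dFj _] := dF2 j; exact: dFj.
Qed.

End SmoothFields.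

(** * Orthonormal expansions in the tangent space and in the distribution *)

Section FrameGeometry.
Context {R : realType}.
Notation E := 'rV[R]_(4 + 3).+1.
Notation SS := (sphere R (4 + 3)).
Implicit Types (u v z : E).

(** The dimensions [4 + 4] and [(4 + 3).+1] are convertible; the linear structure is repacked at the
    type used for the sphere. *)
Definition XTl (l : 'I_4) : {linear E -> E} :=
  HB.pack (XT l : E -> E)
    (GRing.isLinear.Build R 'rV[R]_(4 + 4) 'rV[R]_(4 + 4) *:%R _ (@XT_is_linear R l)).

Definition VTl (k : 'I_3) : {linear E -> E} :=
  HB.pack (VT k : E -> E)
    (GRing.isLinear.Build R 'rV[R]_(4 + 4) 'rV[R]_(4 + 4) *:%R _ (@VT_is_linear R k)).

Lemma dotp_FT (i j : 'I_(4 + 3)) z :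
  dotp (FT i z : E) (FT j z) = (i == j)%:R * dotp z z.
Proof.
case: (split_ordP i) => k ->; case: (split_ordP j) => l ->;
  rewrite ?FT_lshift ?FT_rshift ?eq_lshift ?eq_rshift ?eq_lrshift ?eq_rlshift.
- exact: dotp_XT.
- by rewrite mul0r dotpC; exact: dotp_VT_XT.
- by rewrite mul0r; exact: dotp_VT_XT.
- exact: dotp_VT.
Qed.

Lemma dotp_FT_id i z : dotp (FT i z : E) z = 0.
Proof.
case: (split_ordP i) => k ->; rewrite ?FT_lshift ?FT_rshift.
- exact: dotp_XT_id.
- exact: dotp_VT_id.
Qed.

Lemma FT_tangent i z : (FT i z : E) \in tangent z.
Proof. by rewrite tangentE dotp_FT_id. Qed.

Lemma XT_tangent l z : (XT l z : E) \in tangent z.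
Proof. by rewrite -FT_lshift; exact: FT_tangent. Qed.

Lemma frame_orthogonal z : SS z ->
  volmx z (FT^~ z) *m (volmx z (FT^~ z))^T = 1%:M.
Proof.
move=> /sphereP z1; apply/matrixP => i j.
rewrite [RHS]mxE.
transitivity (dotp (row i (volmx z (FT^~ z))) (row j (volmx z (FT^~ z)))).
  by rewrite mxE dotpE; apply: eq_bigr => k _; rewrite !mxE.
have r0 : row ord0 (volmx z (FT^~ z)) = z by apply/rowP => k; rewrite mxE volmx0.
have rS k : row (lift ord0 k) (volmx z (FT^~ z)) = FT k z.
  by apply/rowP => m; rewrite mxE volmxS.
case: (unliftP ord0 i) => [i' ->|->]; case: (unliftP ord0 j) => [j' ->|->];
  rewrite ?r0 ?rS.
- by rewrite dotp_FT z1 mulr1 (inj_eq lift_inj).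
- by rewrite dotp_FT_id eq_sym (negPf (neq_lift _ _)).
- by rewrite dotpC dotp_FT_id (negPf (neq_lift _ _)).
- by rewrite z1 eqxx.
Qed.

Lemma det_frame_neq0 z : SS z -> \det (volmx z (FT^~ z)) != 0.
Proof.
move=> /frame_orthogonal /(congr1 determinant); rewrite det_mulmx det1 => h.
by apply/eqP => h0; move: h; rewrite h0 mul0r => /eqP; rewrite eq_sym oner_eq0.
Qed.

(** For a square matrix, orthonormal rows give [N^T *m N = 1%:M], so [u = u *m N^T *m N] is the
    expansion of [u]; tangency removes the term along [z]. *)
Lemma tangent_decomp u z : SS z -> u \in tangent z ->
  u = \sum_l dotp u (XT l z) *: (XT l z : E) + \sum_k dotp u (VT k z) *: (VT k z : E).
Proof.
move=> zS ut; have := frame_orthogonal zS.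
set N := volmx z _ => /mulmx1C NN.
transitivity (\sum_i dotp u (FT i z) *: (FT i z : E)); last first.
  rewrite big_split_ord /=; congr (_ + _); apply: eq_bigr => l _.
    by rewrite FT_lshift.
  by rewrite FT_rshift.
rewrite -[LHS]mulmx1 -NN mulmxA mulmx_sum_row big_ord_recl.
have -> : (u *m N^T) 0 ord0 = 0.
  move: ut; rewrite tangentE => /eqP <-; rewrite mxE dotpE.
  by apply: eq_bigr => k _; rewrite mxE volmx0.
rewrite scale0r add0r; apply: eq_bigr => i _; congr (_ *: _).
  by rewrite mxE dotpE; apply: eq_bigr => k _; rewrite mxE volmxS.
by apply/rowP => m; rewrite mxE volmxS.
Qed.

Lemma XT_HT l z : (XT l z : E) \in (HT z : {vspace E}).
Proof. exact/memv_span/(codom_f (fun l => XT l z : E)). Qed.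

(** [tangent w] is the orthogonal complement of any vector [w]; with [w = VT k z] the claim is an
    inclusion of subspaces, checked on generators. *)
Lemma HT_dotp_VT k z u : u \in (HT z : {vspace E}) -> dotp u (VT k z) = 0.
Proof.
move=> uH; apply/eqP; rewrite -tangentE; move: u uH; apply/subvP/span_subvP => u.
by case/(@codomP _ _ (fun l => XT l z : E)) => l ->;
   rewrite tangentE dotpC; apply/eqP; exact: dotp_VT_XT.
Qed.

Lemma HT_tangent z u : u \in (HT z : {vspace E}) -> u \in tangent z.
Proof.
move: u; apply/subvP/span_subvP => u.
by case/(@codomP _ _ (fun l => XT l z : E)) => l ->; exact: XT_tangent.
Qed.

Lemma HT_decomp z u : SS z -> u \in (HT z : {vspace E}) ->
  u = \sum_l dotp u (XT l z) *: (XT l z : E).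
Proof.
move=> zS uH; rewrite [LHS](tangent_decomp zS (HT_tangent uH)).
rewrite [X in _ + X]big1 ?addr0// => k _.
by rewrite HT_dotp_VT// scale0r.
Qed.

Lemma dotp_HT_XT z u v : SS z -> u \in (HT z : {vspace E}) ->
  dotp u v = \sum_l dotp u (XT l z) * dotp (XT l z) v.
Proof.
move=> zS uH; rewrite [in LHS](HT_decomp zS uH) dotp_suml.
by apply: eq_bigr => l _; rewrite dotpZl.
Qed.

Lemma scalarE (eta : {scalar E}) u : eta u = dotp u (\row_i eta (delta_mx 0 i)).
Proof.
rewrite [in LHS](row_sum_delta u) linear_sum dotpE.
by apply: eq_bigr => i _; rewrite linearZ mxE.
Qed.

Lemma scalar_span0 (eta : {scalar E}) (vs : seq E) u :
  (forall v, v \in vs -> eta v = 0) -> u \in <<vs>>%VS -> eta u = 0.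
Proof.
move=> vs0 uvs; apply/eqP; rewrite scalarE -tangentE; move: u uvs.
apply/subvP/span_subvP => v vvs.
by rewrite tangentE -scalarE vs0.
Qed.

End FrameGeometry.

(** The Frobenius product as a trace: cyclicity then gives its invariance under orthogonal
    conjugation. *)
Lemma sum_mul_trace (R : comNzRingType) m n (A B : 'M[R]_(m, n)) :
  \sum_i \sum_j A i j * B i j = \tr (A *m B^T).
Proof.
apply: eq_bigr => i _; rewrite mxE; apply: eq_bigr => j _.
by rewrite mxE.
Qed.

(** * Skew-symmetry of the horizontal fields *)

Section FrameSkew.
Context {R : realType}.
Notation E := 'rV[R]_(4 + 3).+1.
Implicit Types (u v z : E).

(** Polarization of [dotp_XT_id]. *)
Lemma dotp_XT_skew l u v : dotp (XT l u : E) v = - dotp u (XT l v : E).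
Proof.
have XT0 w : dotp (XT l w : E) w = 0 by exact: dotp_XT_id.
have := XT0 (u + v); rewrite -[XT l _]/(XTl l _) linearD /=.
rewrite dotpDl !dotpDr !XT0 add0r addr0 (dotpC (XT l v)) => /eqP.
by rewrite addr_eq0 => /eqP.
Qed.

Lemma TT_tangent k l z : (TT k l z : E) \in tangent z.
Proof.
rewrite tangentE /TT dotpBl (dotp_XT_skew l (XT k z)) (dotp_XT_skew k (XT l z)).
by rewrite (dotpC (XT k z)) subrr.
Qed.

End FrameSkew.

(** * Popp's construction in an arbitrary adapted frame *)

Section AdaptedFrame.
Context {R : realType}.
Notation E := 'rV[R]_(4 + 3).+1.
Notation SS := (sphere R (4 + 3)).
Variables (U : set E) (X : 'I_(4 + 3) -> E -> E).
Variables (eta : 'I_(4 + 3) -> E -> {scalar E}) (z : E).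
Hypotheses (oU : open U) (aX : @adapted_frame R 4 3 HT U X).
Hypotheses (dX : dual_coframe U X eta) (Uz : U z) (zS : SS z).

Let A : 'M[R]_4 := \matrix_(i, l) dotp (X (lshift 3 i) z) (XT l z).
Let t k : 'M[R]_4 := \matrix_(i, j) eta (rshift 4 k) z (TT i j z : E).
Let e : 'M[R]_3 := \matrix_(k, p) eta (rshift 4 k) z (VT p z : E).

Lemma adapted_tangent i w : U w -> SS w -> X i w \in tangent w.
Proof.
move=> Uw wS; have [_ /(_ w Uw wS)[b _ _]] := aX.
by apply: (basis_mem b); exact: (codom_f (X^~ w)).
Qed.

Lemma adapted_HT i w : U w -> SS w -> X (lshift 3 i) w \in (HT w : {vspace E}).
Proof.
move=> Uw wS; have [_ /(_ w Uw wS)[_ b _]] := aX.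
by apply: (basis_mem b); exact: (codom_f (fun i => X (lshift 3 i) w)).
Qed.

Lemma adapted_sdifferentiable i : sdifferentiable (X i) z.
Proof. by have [sX _] := aX; exact: smooth_field_sdifferentiable (sX i). Qed.

(** A vertical covector kills the horizontal fields of [X], hence their span, which contains the
    [XT]. *)
Lemma coframe_XT k l : eta (rshift 4 k) z (XT l z : E) = 0.
Proof.
have [_ /(_ z Uz zS)[_ b _]] := aX.
apply: (@scalar_span0 _ _ [seq X (lshift 3 i) z | i : 'I_4]).
  move=> v /(@codomP _ _ (fun i => X (lshift 3 i) z)) [i ->].
  by rewrite dX// eq_rlshift.
by rewrite (span_basis b); exact: XT_HT.
Qed.

Lemma coframe_tangent k u : u \in tangent z ->
  eta (rshift 4 k) z u = \sum_p dotp (VT p z) u * e k p.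
Proof.
move=> ut; rewrite [in LHS](tangent_decomp zS ut) linearD !linear_sum /=.
rewrite big1 ?add0r; last by move=> l _; rewrite linearZ /= coframe_XT mulr0.
by apply: eq_bigr => p _; rewrite linearZ /= mxE dotpC.
Qed.

Lemma adapted_orthogonal : A *m A^T = 1%:M.
Proof.
have [_ /(_ z Uz zS)[_ _ o]] := aX.
apply/matrixP => i j; rewrite mxE [RHS]mxE -o (dotp_HT_XT _ zS (adapted_HT i Uz zS)).
by apply: eq_bigr => l _; rewrite !mxE; congr (_ * _); exact: dotpC.
Qed.

(** Expanding the field in the [XT], the derivatives of the coefficients multiply horizontal
    vectors, which a vertical covector kills: modulo the distribution only the coefficients
    themselves matter. *)
Lemma coframe_sdiff k j u : u \in tangent z ->
  eta (rshift 4 k) z (sdiff (X (lshift 3 j)) z u)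
  = \sum_l A j l * eta (rshift 4 k) z (XT l u : E).
Proof.
move=> ut; have dj := adapted_sdifferentiable (lshift 3 j).
have dXT l : sdifferentiable (XT l : E -> E) z := sdifferentiable_linear (XTl l) zS.
have da l : sdifferentiable (fun w : E => dotp (X (lshift 3 j) w) (XT l w : E)) z.
  exact: sdifferentiable_dotp.
rewrite (@eq_sdiff _ _ _ U _
  (fun w => \sum_l dotp (X (lshift 3 j) w) (XT l w) *: (XT l w : E)))//; last first.
  by move=> w Uw wS; rewrite [LHS](HT_decomp wS (adapted_HT j Uw wS)).
rewrite sdiff_bigsum; last by move=> l; exact: sdifferentiable_scale.
rewrite linear_sum; apply: eq_bigr => l _.
rewrite sdiff_scale// linearD !linearZ /= coframe_XT mulr0 add0r mxE.
rewrite (sdiff_linear (XTl l) _ zS).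
by move: ut; rewrite tangentE => /eqP ->; rewrite scale0r subr0.
Qed.

(** Modulo the distribution the bracket is bilinear over functions, so a change of horizontal frame
    acts by congruence. *)
Lemma structure_coefE k i j :
  structure_coef X eta z k i j = (A *m t k *m A^T) i j.
Proof.
have X_tan i' : X (lshift 3 i') z \in tangent z by exact: adapted_tangent.
have etaXT l m : eta (rshift 4 k) z (XT l (X (lshift 3 m) z) : E)
    = \sum_p A m p * eta (rshift 4 k) z (XT l (XT p z : E) : E).
  rewrite [X (lshift 3 m) z in LHS](HT_decomp zS (adapted_HT m Uz zS)).
  rewrite -[XT l _]/(XTl l _) !linear_sum; apply: eq_bigr => p _.
  by rewrite !linearZ /= mxE.
rewrite /structure_coef /bracket linearB /= !coframe_sdiff//.
under eq_bigr do rewrite etaXT mulr_sumr.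
under [X in _ - X]eq_bigr do rewrite etaXT mulr_sumr.
rewrite [X in _ - X]exchange_big -sumrB [RHS]mxE /=.
apply: eq_bigr => l _; rewrite [in RHS]mxE mulr_suml -sumrB.
apply: eq_bigr => p _; rewrite !mxE /TT linearB /=.
ring.
Qed.

Let normx := dotp (xpart z) (xpart z).
Let normy := dotp (ypart z) (ypart z).

(** Orthogonality of [A] removes it from the trace, and the [VT] diagonalize the brackets; the
    vertical part [e] stays as a Gram factor. *)
Lemma popp_mxE :
  popp_mx X eta z = (16 * (normx ^+ 2 + normy ^+ 2)) *: (e *m e^T).
Proof.
apply/matrixP => k l; rewrite mxE.
under eq_bigr do under eq_bigr do rewrite !structure_coefE.
have AA := mulmx1C adapted_orthogonal.
rewrite sum_mul_trace !trmx_mul trmxK -!mulmxA (mulmxA A^T) AA.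
rewrite mul1mx mxtrace_mulC -!mulmxA AA mulmx1 -sum_mul_trace.
have tE m i j : t m i j = \sum_p dotp (VT p z : E) (TT i j z) * e m p.
  by rewrite mxE coframe_tangent//; exact: TT_tangent.
transitivity (\sum_p \sum_q e k p * e l q *
   \sum_i \sum_j dotp (VT p z : E) (TT i j z) * dotp (VT q z : E) (TT i j z)).
  transitivity (\sum_i \sum_j \sum_p \sum_q e k p * e l q *
      (dotp (VT p z : E) (TT i j z) * dotp (VT q z : E) (TT i j z))).
    apply: eq_bigr => i _; apply: eq_bigr => j _; rewrite !tE mulr_suml.
    apply: eq_bigr => p _; rewrite mulr_sumr; apply: eq_bigr => q _; ring.
  under eq_bigr => i _ do rewrite exchange_big.
  rewrite exchange_big; apply: eq_bigr => p _.
  under eq_bigr => i _ do rewrite exchange_big.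
  rewrite exchange_big; apply: eq_bigr => q _.
  by rewrite mulr_sumr; apply: eq_bigr => i _; rewrite mulr_sumr.
rewrite [RHS]mxE [X in _ * X]mxE mulr_sumr; apply: eq_bigr => p _.
rewrite (bigD1 p)//= [X in _ + X]big1 ?addr0; last first.
  by move=> q qp; rewrite sum_dotp_VT_TT eq_sym (negPf qp) !mulr0.
by rewrite sum_dotp_VT_TT eqxx mulr1 [e^T _ _]mxE mulrC.
Qed.

(* Its columns are the linear forms dual to the basis (z, X_1 z, ..., X_7 z):
   nothing is assumed on the value of eta k z at the normal vector z. *)
Let h : 'M[R]_((4 + 3).+1) := \matrix_(i, j)
  oapp (fun k => eta k z (delta_mx 0 i) - eta k z z * z 0 i) (z 0 i) (unlift ord0 j).

Let h0 u : (u *m h) 0 ord0 = dotp u z.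
Proof. by rewrite mxE dotpE; apply: eq_bigr => i _; rewrite mxE unlift_none. Qed.

Let hS u k : (u *m h) 0 (lift ord0 k) = eta k z u - eta k z z * dotp u z.
Proof.
rewrite mxE scalarE !dotpE mulr_sumr -sumrB; apply: eq_bigr => i _.
rewrite !mxE liftK /=; ring.
Qed.

(** The corrected forms vanish at [z], so row zero of the product is the first unit vector, and
    expansion along it leaves the coframe matrix. *)
Lemma det_volmx_coframe (v : 'I_(4 + 3) -> E) : (forall j, v j \in tangent z) ->
  \det (volmx z v) * \det h = \det (\matrix_(j, k) eta k z (v j)).
Proof.
have /sphereP z1 := zS; move=> vt; rewrite -det_mulmx (expand_det_row _ ord0).
have rowE i j : (volmx z v *m h) i j = (oapp v z (unlift ord0 i) *m h) 0 j.
  by rewrite mxE [RHS]mxE; apply: eq_bigr => k _; rewrite [in LHS]mxE.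
rewrite big_ord_recl big1 ?addr0; last first.
  by move=> k _; rewrite rowE unlift_none /= hS z1 mulr1 subrr mul0r.
rewrite rowE unlift_none /= h0 z1 mul1r /cofactor addn0 expr0 mul1r.
congr (\det _); apply/matrixP => j k; rewrite [LHS]mxE [LHS]mxE rowE liftK /= hS.
by move: (vt j); rewrite tangentE => /eqP ->; rewrite mulr0 subr0 mxE.
Qed.

Let det_volmx_frame : \det (volmx z (X^~ z)) * \det h = 1.
Proof.
rewrite det_volmx_coframe; last by move=> j; exact: adapted_tangent.
rewrite -[RHS](det1 _ (4 + 3)); congr (\det _); apply/matrixP => j k.
by rewrite !mxE dX// eq_sym.
Qed.

Lemma det_coframe (v : 'I_(4 + 3) -> E) : (forall j, v j \in tangent z) ->
  \det (volmx z (X^~ z)) * \det (\matrix_(k, j) eta k z (v j))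
  = \det (volmx z v).
Proof.
move=> vt; rewrite -[X in _ * X]det_tr -[RHS]mulr1 -det_volmx_frame.
rewrite [RHS]mulrCA det_volmx_coframe//; congr (_ * \det _).
by apply/matrixP => j k; rewrite !mxE.
Qed.

(** Horizontally [X] differs from [XT] by an orthogonal matrix, so up to sign [\det e] is the
    inverse of [\det (volmx z (X^~ z))]; squaring removes the sign. *)
Lemma det_popp_mx :
  \det (popp_mx X eta z) * \det (volmx z (X^~ z)) ^+ 2
  = (16 * (normx ^+ 2 + normy ^+ 2)) ^+ 3.
Proof.
have hX := det_volmx_frame.
have hF : \det (volmx z (FT^~ z)) * \det h
    = \det (\matrix_(l, i) eta (lshift 3 i) z (XT l z : E)) * \det e.
  rewrite det_volmx_coframe; last by move=> j; exact: FT_tangent.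
  rewrite -(det_tr e).
  (* Block triangular by [coframe_XT]. *)
  rewrite -(det_lblock _ (\matrix_(p, i) eta (lshift 3 i) z (VT p z : E))).
  congr (\det _); apply/matrixP => j k; rewrite mxE.
  case: (split_ordP j) => j' ->; case: (split_ordP k) => k' ->;
    rewrite ?FT_lshift ?FT_rshift;
    rewrite ?(block_mxEul, block_mxEur, block_mxEdl, block_mxEdr) !mxE//.
  exact: coframe_XT.
have hA : \det A * \det (\matrix_(l, i) eta (lshift 3 i) z (XT l z : E)) = 1.
  rewrite -det_mulmx -[RHS](det1 _ 4); congr (\det _); apply/matrixP => j i.
  rewrite [RHS]mxE -(inj_eq (@lshift_inj 4 3)) eq_sym -(dX Uz zS).
  rewrite [X in eta _ _ X](HT_decomp zS (adapted_HT j Uz zS)) linear_sum mxE.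
  by apply: eq_bigr => l _; rewrite linearZ !mxE.
have detA : \det A ^+ 2 = 1.
  by rewrite expr2 -{2}(det_tr A) -det_mulmx adapted_orthogonal det1.
have detN : \det (volmx z (FT^~ z)) ^+ 2 = 1.
  by rewrite expr2 -{2}det_tr -det_mulmx frame_orthogonal// det1.
rewrite popp_mxE detZ det_mulmx det_tr.
set M := \det (volmx z (X^~ z)) in hX *.
set N := \det (volmx z (FT^~ z)) in hF detN.
have -> : \det e = N * \det h * \det A.
  by rewrite hF mulrAC [X in X * _]mulrC hA mul1r.
transitivity ((16 * (normx ^+ 2 + normy ^+ 2)) ^+ 3
    * (N ^+ 2) * (\det A ^+ 2) * (M * \det h) ^+ 2).
  ring.
by rewrite detN detA hX expr1n !mulr1.
Qed.

End AdaptedFrame.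

(** * The density [e^h] and the local form of Popp measures *)

Section Density.
Context {R : realType}.
Notation E := 'rV[R]_(4 + 3).+1.
Notation SS := (sphere R (4 + 3)).
Implicit Types (u v w z : E).

Let q z : R := 1 - 2 * dotp (xpart z) (xpart z) * dotp (ypart z) (ypart z).

Lemma hTE z : hT z = - (3 / 2) * ln (q z).
Proof. by rewrite /hT !enorm_sqr. Qed.

Lemma q_sphere z : SS z ->
  q z = dotp (xpart z) (xpart z) ^+ 2 + dotp (ypart z) (ypart z) ^+ 2.
Proof.
move=> /sphereP; have -> : dotp z z = _ := dotp_parts _ _.
by rewrite /q addrC => /(canRL (addrK _)) ->; ring.
Qed.

(** Keeps [ln (q z)] away from the default value of [ln] at nonpositive arguments. *)
Lemma q_gt0 z : SS z -> 0 < q z.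
Proof.
move=> zS; rewrite q_sphere//; move/sphereP: zS.
have -> : dotp z z = _ := dotp_parts _ _.
set a := dotp _ _; set b := dotp _ _; rewrite addrC => /(canRL (addrK _)) ->.
have -> : a ^+ 2 + (1 - a) ^+ 2 = 2 * (a - 1 / 2) ^+ 2 + 1 / 2 by field.
by rewrite ltr_wpDl// mulr_ge0// sqr_ge0.
Qed.

(** Both factors are nonnegative, so comparing squares suffices and turns the exponent 3/2 into
    3. *)
Lemma expR_hT z : SS z -> expR (hT z) * Num.sqrt (q z ^+ 3) = 1.
Proof.
move=> zS; have q0 := q_gt0 zS; apply/eqP.
rewrite -(@eqrXn2 _ 2)// ?mulr_ge0 ?expR_ge0 ?sqrtr_ge0// expr1n exprMn.
rewrite sqr_sqrtr ?exprn_ge0 ?ltW// -expRM_natl hTE.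
have -> : 2 * (- (3 / 2) * ln (q z)) = - (3 * ln (q z)) by field.
by rewrite expRN expRM_natl lnK ?posrE// mulVf// expf_neq0// gt_eqF.
Qed.

Lemma sdifferentiable_hT z : SS z -> sdifferentiable (hT : E -> R) z.
Proof.
move=> zS; have q0 := q_gt0 zS.
have dq : sdifferentiable q z.
  apply: differentiable_sdifferentiable => //.
  have dx : differentiable (fun w : E => dotp (xpart w) (xpart w)) z.
    by apply: differentiable_dotp; exact: (@differentiable_lsubmx _ _ 4 4).
  have dy : differentiable (fun w : E => dotp (ypart w) (ypart w)) z.
    by apply: differentiable_dotp; exact: (@differentiable_rsubmx _ _ 4 4).
  apply: differentiableB; first exact: differentiable_cst.
  apply: differentiable_mul dy; apply: differentiable_mul dx.
  exact: differentiable_cst.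
have -> : (hT : E -> R) = (fun w => - (3 / 2) * (@ln R \o q) w).
  by apply/funext => w; exact: hTE.
apply: sdifferentiable_mul; first exact: sdifferentiable_cst.
apply: sdifferentiable_comp1 => //.
by apply: ex_derive; exact: is_derive1_ln.
Qed.

Lemma sdiff_expR_hT z v : SS z ->
  sdiff (fun w : E => expR (hT w)) z v = expR (hT z) * sdiff (hT : E -> R) z v.
Proof.
move=> zS; rewrite [LHS](@sdiff_comp1 _ _ (@expR R))//.
- by rewrite mulrC; congr (_ * _); have [] := is_derive_expR (hT z).
- exact: sdifferentiable_hT.
Qed.

Lemma sdifferentiable_expR_hT z : SS z ->
  sdifferentiable (fun w : E => expR (hT w)) z.
Proof.
move=> zS; apply: (@sdifferentiable_comp1 _ _ (@expR R)) => //.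
exact: sdifferentiable_hT.
Qed.

Lemma sdifferentiable_det_volmx (Y : 'I_(4 + 3) -> E -> E) z : SS z ->
  (forall i, sdifferentiable (Y i) z) ->
  sdifferentiable (fun w => \det (volmx w (Y^~ w))) z.
Proof.
move=> zS dY; apply: sdifferentiable_det => i j.
case: (unliftP ord0 i) => [i' ->|->].
  by under eq_fun do rewrite volmxS; exact: sdifferentiable_coord.
under eq_fun do rewrite volmx0.
apply: sdifferentiable_coord.
exact: differentiable_sdifferentiable zS (differentiable_id z).
Qed.

(** [det_popp_mx] fixes only the product of [Num.sqrt B] with the absolute value of [M]; the sign of
    [M] is all that survives of the choice of frame. The 64 is the square root of [16 ^+ 3]. *)
Lemma popp_frame (U : set E) X eta z (v : 'I_(4 + 3) -> E) : open U ->
  @adapted_frame R 4 3 HT U X -> dual_coframe U X eta -> U z -> SS z ->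
  (forall j, v j \in tangent z) ->
  (Num.sqrt (\det (popp_mx X eta z)))^-1 * \det (\matrix_(k, j) eta k z (v j))
  = Num.sg (\det (volmx z (X^~ z))) / 64 * expR (hT z) * \det (volmx z v).
Proof.
move=> oU aX dX Uz zS vt.
rewrite -(det_coframe aX dX Uz zS vt) mulrA; congr (_ * _).
have := det_popp_mx oU aX dX Uz zS; rewrite -q_sphere//.
set M := \det (volmx _ _); set B := \det (popp_mx _ _ _) => BM.
have q0 := q_gt0 zS.
have BM0 : B * M ^+ 2 != 0 by rewrite BM gt_eqF// exprn_gt0// mulr_gt0.
have M0 : M != 0 by apply: contraNneq BM0 => ->; rewrite expr0n mulr0.
have M20 : 0 < M ^+ 2 by rewrite exprn_even_gt0.
have B0 : 0 < B by rewrite -(pmulr_lgt0 B M20) BM exprn_gt0// mulr_gt0.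
have sBM : Num.sqrt B * `|M| = 64 * Num.sqrt (q z ^+ 3).
  rewrite -sqrtr_sqr -sqrtrM ?(ltW B0)// BM exprMn sqrtrM ?exprn_ge0//.
  congr (_ * _); rewrite (_ : 16 ^+ 3 = 64 ^+ 2 :> R); last by ring.
  by rewrite sqrtr_sqr ger0_norm.
have e1 := expR_hT zS.
have sB0 : Num.sqrt B != 0 by rewrite gt_eqF// sqrtr_gt0.
apply: (mulfI sB0); rewrite mulfV//.
transitivity ((Num.sqrt B * `|M|) * expR (hT z) / 64).
  by rewrite sBM -[LHS]e1; field.
by rewrite normrEsg; field.
Qed.

(** The orientation of [X] could change within [U]; the neighbourhood is shrunk until it is the one
    at [z], which makes the factor constant. *)
Lemma popp_local (P : E -> ('I_(4 + 3) -> E) -> R) z : SS z -> @is_popp R 4 3 HT P ->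
  exists U c, [/\ open U, U z, c != 0 &
    forall w, U w -> SS w -> forall v : 'I_(4 + 3) -> E,
      (forall j, v j \in tangent w) ->
      P w v = c * (expR (hT w) * \det (volmx w v))].
Proof.
move=> zS /(_ z zS) [U [X [eta [oU Uz aX dX PE]]]].
set s := Num.sg (\det (volmx z (X^~ z))).
have D0 : \det (volmx z (X^~ z)) != 0.
  have := det_popp_mx oU aX dX Uz zS; rewrite -q_sphere// => h.
  apply/eqP => D0; move: h; rewrite D0 expr0n mulr0 => /eqP.
  by rewrite eq_sym gt_eqF// exprn_gt0// mulr_gt0// q_gt0.
have [|||V [oV Vz sD]] := @sdifferentiable_gt0 _ _
    (fun w => s * \det (volmx w (X^~ w))) z => //.
- apply: sdifferentiable_mul; first exact: sdifferentiable_cst.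
  apply: sdifferentiable_det_volmx => // i.
  exact: adapted_sdifferentiable oU aX Uz zS i.
- by rewrite /s -normrEsg normr_gt0.
exists (U `&` V)%classic, (s / 64); split => //.
- exact: openI.
- by rewrite mulf_neq0// sgr_eq0.
move=> w [Uw Vw] wS v vt; rewrite PE// (popp_frame oU aX dX)// -!mulrA.
congr (_ * _); have := sD w Vw wS; rewrite -sgr_gt0 sgrM /s sgr_id.
by case: sgrP => _; case: sgrP => _;
   rewrite ?(mulr0, mul0r, mulr1, mul1r, mulrN1, ltxx, ltr0N1).
Qed.

Lemma Lie_popp (P : E -> ('I_(4 + 3) -> E) -> R) (G : E -> E)
    (Y : 'I_(4 + 3) -> E -> E) z :
  SS z -> @is_popp R 4 3 HT P ->
  sdifferentiable G z -> (forall w, SS w -> G w \in tangent w) ->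
  (forall i, sdifferentiable (Y i) z) ->
  (forall i w, SS w -> Y i w \in tangent w) ->
  @Lie_form R 4 3 G P Y z = (fder G hT z + \tr (sdiff_mx G z)) * P z (Y^~ z).
Proof.
move=> zS pP dG Gt dY Yt; have [U [c [oU Uz _ PE]]] := popp_local zS pP.
have dh := sdifferentiable_expR_hT zS.
have dD := sdifferentiable_det_volmx zS dY.
rewrite /Lie_form /fder.
rewrite (@eq_sdiff _ _ _ U _
  (fun w => c * (expR (hT w) * \det (volmx w (Y^~ w)))))//; last first.
  by move=> w Uw wS; apply: PE => // j; exact: Yt.
rewrite sdiff_mul//; last 2 first.
- exact: sdifferentiable_cst.
- exact: sdifferentiable_mul.
rewrite [sdiff (fun=> c) z _]derive_cst mul0r add0r sdiff_mul// sdiff_expR_hT//.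
(* [P] is known on tangent vectors only, hence the need for a tangent bracket. *)
under eq_bigr => i _.
  rewrite PE//; last first.
    move=> j; case: eqP => _; last exact: Yt.
    exact: bracket_tangent (Yt i) _ (dY i).
  over.
rewrite -mulr_sumr -mulr_sumr PE//; last by move=> j; exact: Yt.
have := Lie_vol zS dG (Gt z zS) dY (fun i => Yt i z zS).
rewrite /fder => /eqP; rewrite subr_eq => /eqP ->.
ring.
Qed.

End Density.

(** * Existence of a Popp form *)

Section GlobalFrame.
Context {R : realType}.
Notation E := 'rV[R]_(4 + 3).+1.
Notation SS := (sphere R (4 + 3)).
Implicit Types (u v w z : E).

Lemma free_orthonormal m (F : 'I_m -> E) :
  (forall i j, dotp (F i) (F j) = (i == j)%:R) -> free [seq F i | i : 'I_m].
Proof.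
move=> oF; have [T <- TE] : exists2 T : m.-tuple E,
    tval T = [seq F i | i : 'I_m] & forall i : 'I_m, T`_i = F i.
  by exists [tuple F i | i < m] => // i; rewrite -tnth_nth tnth_mktuple.
apply/freeP => k k0 i; have := dotp0r (F i); rewrite -k0 dotp_sumr (bigD1 i)//=.
rewrite big1 ?addr0; first by rewrite dotpZr TE oF eqxx mulr1.
by move=> j ji; rewrite dotpZr TE oF eq_sym (negPf ji) mulr0.
Qed.

Lemma FT_smooth i S : smooth_field_on S (FT i : E -> E).
Proof.
case: (split_ordP i) => k ->; rewrite ?FT_lshift ?FT_rshift.
- exact: smooth_linear_field (XTl k).
- exact: smooth_linear_field (VTl k).
Qed.

Lemma FT_adapted : @adapted_frame R 4 3 HT setT (fun i => FT i : E -> E).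
Proof.
have oF z : SS z -> forall i j, dotp (FT i z : E) (FT j z) = (i == j)%:R.
  by move=> /sphereP z1 i j; rewrite dotp_FT z1 mulr1.
split=> [i|z _ zS]; first exact: FT_smooth.
split; last by move=> i j; rewrite oF// eq_lshift.
- rewrite /basis_of free_orthonormal ?andbT; last exact: oF.
  rewrite eqEsubv; apply/andP; split.
    apply/span_subvP => u /(@codomP _ _ (fun i => FT i z : E)) [i ->].
    exact: FT_tangent.
  have FTs i : (FT i z : E) \in <<[seq (FT i z : E) | i : 'I_(4 + 3)]>>%VS.
    exact/memv_span/(codom_f (fun i => FT i z : E)).
  apply/subvP => u ut; rewrite (tangent_decomp zS ut).
  apply: memvD; apply: memv_suml => k _; apply: memvZ.
    by rewrite -FT_lshift.
  by rewrite -FT_rshift.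
- rewrite /basis_of free_orthonormal ?andbT; last first.
    by move=> i j; rewrite oF// eq_lshift.
  rewrite /HT; apply/eqP; congr (<<_>>%VS).
  by apply: eq_image => // l; rewrite FT_lshift.
Qed.

Definition FT_coframe (i : 'I_(4 + 3)) z : {scalar E} := dotp_scalar (FT i z : E).

Lemma FT_dual : dual_coframe setT (fun i => FT i : E -> E) FT_coframe.
Proof.
move=> z _ /sphereP z1 k j; rewrite -[LHS]/(dotp (FT j z : E) (FT k z)).
by rewrite dotp_FT z1 mulr1 eq_sym.
Qed.

(** The frame is global, so a single formula serves at every point and no local signs have to be
    matched. *)
Lemma popp_exists : exists P, @is_popp R 4 3 HT P.
Proof.
exists (fun z (v : 'I_(4 + 3) -> E) =>
  (Num.sqrt (\det (popp_mx (fun i => FT i : E -> E) FT_coframe z)))^-1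
  * \det (\matrix_(k, j) FT_coframe k z (v j))).
move=> p pS; exists setT, (fun i => FT i : E -> E), FT_coframe; split => //.
- exact: openT.
- exact: FT_adapted.
- exact: FT_dual.
Qed.

End GlobalFrame.

(** * The horizontal gradient and its divergence *)

Section HorizontalGradient.
Context {R : realType}.
Notation E := 'rV[R]_(4 + 3).+1.
Notation SS := (sphere R (4 + 3)).
Implicit Types (u v w z : E).
Variable f : E -> R.
Hypothesis sf : smooth_on SS f.

Let g (l : 'I_4) : E -> R := fder (XT l) f.
Let G z : E := \sum_l g l z *: XT l z.

Let dg l z : SS z -> sdifferentiable (g l) z.
Proof.
move=> zS; apply: (smooth_on_fder_sdifferentiable (X := XTl l)) => //.
by move=> w _; exact: XT_tangent.
Qed.

Lemma hgrad_exists : @is_hgrad R 4 3 HT f G.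
Proof.
move=> z zS; split=> [|v vH].
  by apply: memv_suml => l _; apply: memvZ; exact: XT_HT.
rewrite [v in RHS](HT_decomp zS vH) sdiff_sum; last first.
  exact: smooth_on_sphere_sdifferentiable.
rewrite dotp_suml; apply: eq_bigr => l _.
by rewrite dotpZl mulrC [dotp (XT l z) v]dotpC.
Qed.

Lemma hgradE (G' : E -> E) z : @is_hgrad R 4 3 HT f G' -> SS z -> G' z = G z.
Proof.
move=> hG zS; have [GH GE] := hG z zS.
rewrite (HT_decomp zS GH); apply: eq_bigr => l _.
by rewrite GE//; exact: XT_HT.
Qed.

Let dgX l z : SS z -> sdifferentiable (fun w : E => g l w *: (XT l w : E)) z.
Proof.
move=> zS; apply: sdifferentiable_scale; first exact: dg.
exact (sdifferentiable_linear (XTl l) zS).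
Qed.

Lemma hgrad_sdifferentiable z : SS z -> sdifferentiable G z.
Proof. by move=> zS; apply: sdifferentiable_sum => l; exact: dgX. Qed.

(* The XT l are divergence free, being skew. *)
Lemma trace_hgrad z : SS z -> \tr (sdiff_mx G z) = \sum_l fder (XT l) (g l) z.
Proof.
move=> zS.
transitivity (\sum_l \sum_i
  (sdiff (fun w : E => g l w *: (XT l w : E)) z (delta_mx 0 i)) 0 i).
  rewrite exchange_big; apply: eq_bigr => i _.
  rewrite mxE [sdiff G _ _]sdiff_bigsum ?summxE// => l; exact: dgX.
apply: eq_bigr => l _.
have dXT : sdifferentiable (XT l : E -> E) z := sdifferentiable_linear (XTl l) zS.
(* [sdiff] sees only the tangential part of a basis vector, whence the correction with [z 0 i]; it
   sums to [dotp (XT l z) z], which is zero. *)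
transitivity (\sum_i ((XT l z : E) 0 i * sdiff (g l) z (delta_mx 0 i)
    + g l z * (dotp (XT l (delta_mx 0 i : E) : E) (delta_mx 0 i)
               - (XT l z : E) 0 i * z 0 i))).
  apply: eq_bigr => i _; rewrite sdiff_scale//; last exact: dg.
  rewrite (sdiff_linear (XTl l) _ zS) linearB linearZ /=.
  have dE u : dotp u (delta_mx 0 i) = u 0 i.
    rewrite dotpE (bigD1 i)//= big1 ?addr0 ?mxE ?eqxx ?mulr1// => j ji.
    by rewrite mxE (negPf ji) mulr0.
  rewrite dE (dotpC (delta_mx 0 i)) dE !mxE; ring.
rewrite big_split /= -mulr_sumr sumrB -dotpE dotp_XT_id subr0.
rewrite [X in g l z * X]big1; last first.
  by move=> i _; exact: dotp_XT_id.
rewrite mulr0 addr0 /fder [X in sdiff _ _ X](row_sum_delta (XT l z : E)) sdiff_sum//.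
exact: dg.
Qed.

Lemma fder_hgrad (k : E -> R) z : sdifferentiable k z ->
  fder G k z = \sum_l fder (XT l) k z * g l z.
Proof.
move=> dk; rewrite /fder sdiff_sum//.
by apply: eq_bigr => l _; rewrite mulrC.
Qed.

Lemma Lie_popp_hgrad (P : E -> ('I_(4 + 3) -> E) -> R) (G' : E -> E)
    (Y : 'I_(4 + 3) -> E -> E) z :
  SS z -> @is_popp R 4 3 HT P -> @is_hgrad R 4 3 HT f G' ->
  (forall i, smooth_field_on SS (Y i)) ->
  (forall i w, SS w -> Y i w \in tangent w) ->
  @Lie_form R 4 3 G' P Y z
  = (\sum_l (fder (XT l) (g l) z + fder (XT l) hT z * g l z)) * P z (Y^~ z).
Proof.
move=> zS pP hG sY Yt.
have GE w : SS w -> G w = G' w by move=> wS; rewrite (hgradE hG).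
have sE v : sdiff G' z v = sdiff G z v.
  by apply/esym/(@eq_sdiff _ _ _ setT) => //; [exact: openT|move=> w _; exact: GE].
rewrite Lie_popp//.
- congr (_ * _); rewrite big_split /= addrC; congr (_ + _).
    rewrite /fder -GE// -[LHS]/(fder G hT z) fder_hgrad//.
    exact: sdifferentiable_hT.
  have -> : sdiff_mx G' z = sdiff_mx G z by apply/matrixP => i j; rewrite !mxE sE.
  exact: trace_hgrad.
- apply: (@eq_sdifferentiable _ _ _ setT G) => //; first exact: openT.
    by move=> w _; exact: GE.
  exact: hgrad_sdifferentiable.
- by move=> w wS; apply: HT_tangent; have [] := hG w wS.
- by move=> i; exact: smooth_field_sphere_sdifferentiable.
Qed.

End HorizontalGradient.

Theorem lemma8p2 (R : realType) (f : 'rV[R]_8 -> R)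
    (hf : smooth_on (sphere R 7) f) (g : 'rV[R]_8 -> R) :
  @is_sublaplacian R 4 3 HT f g <->
  forall z, sphere R 7 z ->
    g z = - \sum_(i < 4) (fder (XT i) (fder (XT i) f) z
                          + fder (XT i) hT z * fder (XT i) f z).
Proof.
split=> [[P [G [d [pP hG dG gd]]]] z zS|gE].
  rewrite gd//; congr (- _).
  have [U [c [_ Uz c0 PE]]] := popp_local zS pP.
  (* The global frame supplies the test fields: the divergence identity can be divided by this
     value. *)
  have P0 : P z (FT^~ z) != 0.
    rewrite PE//; last by move=> j; exact: FT_tangent.
    apply: mulf_neq0 => //; apply: mulf_neq0; last exact: det_frame_neq0.
    by rewrite gt_eqF// expR_gt0.
  have FTs i : smooth_field_on (sphere R (4 + 3)) (FT i) by exact: FT_smooth.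
  have FTt i w : sphere R (4 + 3) w -> FT i w \in tangent (w : 'rV[R]_(4 + 3).+1).
    by move=> _; exact: FT_tangent.
  by apply: (mulIf P0); rewrite -(Lie_popp_hgrad hf zS pP hG)// dG.
have [P pP] := popp_exists (R := R).
exists P, (fun z => \sum_l fder (XT l) f z *: XT l z), (fun z => - g z); split => //.
- exact: hgrad_exists.
- move=> Y sY Yt z zS; rewrite gE// opprK.
  by rewrite (Lie_popp_hgrad hf zS pP (hgrad_exists hf)).
- by move=> z _; rewrite opprK.
Qed.
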